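(* Let $n \ge 1$ be an integer and let $I(\Gamma_{n,4})$ be the independence complex of the $(n\times 4)$-grid graph. Writing $n = 6k + l$ with integers $k \ge 0$ and $0 \le l \le 5$, there is a homotopy equivalence \[ I(\Gamma_{n,4}) \simeq \begin{cases} \bigvee_{2k} S^{n-1} & (n = 6k+1) \\ \bigvee_{2k+2} S^{n-1} & (n = 6k + 4) \\ \bigvee_{2k+1} S^{n-1} & (n = 6k + l \text{ with } l = 0,2,3,5). \end{cases}\]
   Context: For a finite simple graph $G=(V,E)$, a subset $\sigma\subset V$ is independent if no two vertices of $\sigma$ are adjacent; the independence complex $I(G)$ is the simplicial complex with vertex set $V$ whose simplices are the independent sets of $G$. Homotopy statements refer to its geometric realization. For positive integers $n,k$, the grid graph $\Gamma_{n,k}$ has vertex set $\{(x,y)\in\mathbb{Z}^2 \mid 1\le x\le n,\ 1\le y\le k\}$, with $(x,y)$ and $(z,w)$ adjacent if and only if $|x-z|+|y-w|=1$. $\bigvee_m S^d$ denotes the wedge of $m$ copies of the sphere $S^d$; a wedge of zero copies is a point. *)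

(* Defs.v *)
From HB Require Import structures.
From mathcomp Require Import all_boot all_order all_algebra.
From mathcomp Require Import all_classical all_reals topology normedtype.
From mathcomp Require Import wedge_sigT.
Set Implicit Arguments.
Unset Strict Implicit.
Unset Printing Implicit Defensive.
Import Order.TTheory GRing.Theory Num.Theory.
Import numFieldNormedType.Exports.
Local Open Scope classical_set_scope.
Local Open Scope ring_scope.

Record simple_graph (V : finType) := SimpleGraph {
  adj :> rel V;
  adj_sym : symmetric adj;
  adj_irr : irreflexive adj
}.

(* As usual in combinatorics, the empty simplex is allowed as a member of
   [simplices]; it has no effect on the geometric realization. *)
Record simplicial_complex (V : finType) := SimplicialComplex {
  simplices :> {set {set V}};
  simplices_vertex : forall v : V, [set v]%SET \in simplices;
  simplices_face : forall A B : {set V},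
    A \subset B -> B \in simplices -> A \in simplices
}.

Section Independence.
Variables (V : finType) (G : simple_graph V).

Definition independent (A : {set V}) : bool :=
  [forall u in A, forall v in A, ~~ G u v].

Definition independent_sets : {set {set V}} :=
  [set A : {set V} | independent A]%SET.

Lemma independent_sets_vertex (v : V) : [set v]%SET \in independent_sets.
Proof.
rewrite inE; apply/forall_inP => u /set1P ->; apply/forall_inP => w /set1P ->.
by rewrite adj_irr.
Qed.

Lemma independent_sets_face (A B : {set V}) :
  A \subset B -> B \in independent_sets -> A \in independent_sets.
Proof.
move=> /fintype.subsetP sAB; rewrite !inE => /forall_inP iB.
apply/forall_inP => u /sAB uB; apply/forall_inP => v /sAB vB.
by have /forall_inP := iB u uB; apply.
Qed.

Definition independence_complex : simplicial_complex V :=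
  SimplicialComplex independent_sets_vertex independent_sets_face.

End Independence.

Section Grid.
Variables n k : nat.

(* The pair (x, y) of ordinals, counted from 0, stands for the grid point
   (x + 1, y + 1); adjacency only involves differences of coordinates. *)
Definition grid_adj : rel ('I_n * 'I_k) := fun p q =>
  `|(p.1 : nat)%:Z - (q.1 : nat)%:Z| + `|(p.2 : nat)%:Z - (q.2 : nat)%:Z| == 1.

Lemma grid_adj_sym : symmetric grid_adj.
Proof.
by move=> p q; rewrite /grid_adj distrC [X in _ + X]distrC.
Qed.

Lemma grid_adj_irr : irreflexive grid_adj.
Proof. by move=> p; rewrite /grid_adj !subrr. Qed.

Definition grid_graph : simple_graph ('I_n * 'I_k)%type :=
  SimpleGraph grid_adj_sym grid_adj_irr.

End Grid.

Section Spaces.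
Variable R : realType.

(* Barycentric coordinates; since [V] is finite, the topology of the
   realization is the one induced by the product topology on R^V. *)
Definition barycentric (V : finType) (K : simplicial_complex V) :
    set {ptws V -> R} :=
  [set x | [/\ forall v, 0 <= x v, \sum_(v : V) x v = 1
             & [set v | x v != 0]%SET \in simplices K]].

Definition realization (V : finType) (K : simplicial_complex V) :
  topologicalType := set_type (barycentric K).

Definition unit_sphere (d : nat) : set 'rV[R]_d.+1 :=
  [set x | \sum_(i < d.+1) x 0 i ^+ 2 = 1].
Arguments unit_sphere : clear implicits.

Definition sphere (d : nat) : topologicalType := set_type (unit_sphere d).

Lemma sphere_base_subproof (d : nat) :
  (delta_mx 0 ord0 : 'rV[R]_d.+1) \in unit_sphere d.
Proof.
rewrite inE /unit_sphere /= (bigD1 ord0) //= mxE !eqxx expr1n big1 ?addr0 //.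
by move=> i i0; rewrite mxE (negPf i0) andbF expr0n.
Qed.

Definition sphere_base (d : nat) : sphere d :=
  exist (fun x => x \in unit_sphere d) _ (sphere_base_subproof d).

(* The library wedge of an empty family is the empty space, whereas here the
   wedge of zero copies of a pointed space is a point. *)
Definition wedge_copies (m : nat) (X : topologicalType) (x0 : X) :
    topologicalType :=
  if m is m'.+1 then wedge (fun _ : 'I_m'.+1 => x0)
  else set_type [set x0].

Definition sphere_wedge (m d : nat) : topologicalType :=
  wedge_copies m (sphere_base d).

Definition homotopic (X Y : topologicalType) (f g : X -> Y) : Prop :=
  exists H : X * R -> Y,
    [/\ {within [set: X] `*` `[0, 1], continuous H},
        forall x, H (x, 0) = f x & forall x, H (x, 1) = g x].

Definition homotopy_equivalent (X Y : topologicalType) : Prop :=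
  exists (f : X -> Y) (g : Y -> X),
    [/\ continuous f, continuous g,
        homotopic (g \o f) idfun & homotopic (f \o g) idfun].

End Spaces.

Arguments unit_sphere : clear implicits.

(* Main.v *)
Require Import Defs.
From mathcomp Require Import all_boot all_order all_algebra.
From mathcomp Require Import all_classical all_reals topology normedtype.
From mathcomp Require Import wedge_sigT zify ring lra.

(** The independence complex of the grid carries a discrete Morse matching, the
empty simplex included, whose critical simplices all have [n] vertices; this alone
makes it a wedge of [(n - 1)]-spheres, one for each critical simplex.

The matching. The independent sets avoiding a vertex [v] form the complex of
[G - v], and those containing [v] are the simplices [v |: s] with [s] in the complex
of [G - N[v]]; matchings of the two parts add up to a matching of the whole
([matching_tree]). If some vertex of [G - N[v]] is isolated there, adding or removing
it matches everything that contains [v], so [v] may be deleted for free: this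
happens as soon as the neighbours of some [u], itself not adjacent to [v], are all
adjacent to [v] ([matching_tree_fold]). An isolated edge of [G] adds one vertex to every
critical simplex ([matching_tree_edge]). On a strip of width four, after some foldings,
splitting at one vertex of the first column leaves isolated edges and a shorter
strip with some vertices of its first column missing. Let [h n] count the critical
simplices of the strip of [n] columns with one corner missing. Then
[h (n + 3) = h n + odd n] ([tree_three_rows]), while the full grid has
[h (n - 2) + h (n - 6)] for [6 <= n] ([tree_full]); since [h (n + 6) = h n + 1], these
numbers are those of the theorem.

The homotopy type. Let all critical simplices have size [c]. Every smaller simplex
is then matched, so the pairs whose smaller member has size less than [c] form a
subcomplex [L] that contains all simplices of size less than [c]. It collapses to a
point, the critical simplices are facets attached to it, and all other pairs can be
collapsed beforehand ([reduces_split]). Hence no attaching map has to be understood.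
An elementary collapse is a deformation retraction, linear along segments in
barycentric coordinates ([collapse_equivalence]). Finally a contraction of [L] extends
to a homotopy of the polyhedron of [L] with its facets, and collapsing [L] to a point
turns each facet, by inverse stereographic projection, into a sphere
([facets_equivalence]). *)

Set Implicit Arguments.
Unset Strict Implicit.
Unset Printing Implicit Defensive.
Import Order.TTheory GRing.Theory Num.Theory.
Import numFieldNormedType.Exports.

(** * Discrete Morse reductions of a finite complex *)

Section Morse.
Import mathcomp.boot.fintype mathcomp.boot.finset.
Variable V : finType.
Implicit Types (A s t : {set V}) (B C D K L U : {set {set V}}).

Definition face_closed K :=
  forall s t : {set V}, s \subset t -> t \in K -> s \in K.

(** [collapses B K]: removing pairs of simplices one at a time, always keeping a
complex, leads from [K] down to [B]. As the intermediate sets are face-closed, [s] is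
a free face of [w |: s] when the pair is removed. *)
Inductive collapses B : {set {set V}} -> Prop :=
| collapses_refl : collapses B B
| collapses_pair K s w : collapses B K ->
    w \notin s -> s \notin K -> w |: s \notin K ->
    face_closed ((w |: s) |: (s |: K)) -> collapses B ((w |: s) |: (s |: K)).

(** Besides pairs, [m] single simplices of size [c] may be removed: these are the
critical simplices of an acyclic matching, which the order of removal encodes. *)
Inductive reduces (c : nat) B : {set {set V}} -> nat -> Prop :=
| reduces_refl : reduces c B B 0
| reduces_pair K s w m : reduces c B K m ->
    w \notin s -> s \notin K -> w |: s \notin K ->
    face_closed ((w |: s) |: (s |: K)) ->
    reduces c B ((w |: s) |: (s |: K)) m
| reduces_critical K s m : reduces c B K m ->
    s \notin K -> #|s| = c -> face_closed (s |: K) ->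
    reduces c B (s |: K) m.+1.

Lemma face_closed0 : face_closed set0.
Proof. by move=> s t _; rewrite inE. Qed.

Lemma reduces_trans c B B' K m m' :
  reduces c B K m -> reduces c B' B m' -> reduces c B' K (m + m').
Proof.
by elim=> *; [|apply: reduces_pair|apply: reduces_critical]; auto.
Qed.

Lemma collapses_sub B K : collapses B K -> B \subset K.
Proof.
by elim=> // {}K s w _ sBK *; rewrite (subset_trans sBK)// setUA subsetUr.
Qed.

(** Pair every simplex avoiding the apex [u] with its union with [u], starting from
the largest ones. *)
Lemma cone_reduces c K (u : V) : face_closed K ->
  (forall s, s \in K -> u |: s \in K) -> reduces c set0 K 0.
Proof.
have [n] := ubnP #|K|; elim: n => // n IHn in K *; move=> /ltnSE leKn clK coneK.
have [->|/set0Pn[t0 t0K]] := eqVneq K set0.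
  exact: reduces_refl.
have K0 : (set0 \in K) && (u \notin set0 (T:=V)).
  by rewrite inE andbT (clK _ _ (sub0set _) t0K).
pose P s := (s \in K) && (u \notin s).
have [t /andP[tK ut] tmax] := @arg_maxnP _ _ P (fun s : {set V} => #|s|) K0.
have ext s : s \in K -> t \subset s -> s = t \/ s = u |: t.
  move=> sK ts; have tsu : t \subset s :\ u by rewrite subsetD1 ts.
  have /eqP E : t == s :\ u.
    rewrite eqEcard tsu; apply: tmax; rewrite /P setD11 andbT.
    by apply: clK sK; exact: subsetDl.
  have [us|us] := boolP (u \in s); first by right; rewrite E setD1K.
  by left; rewrite E; apply/setP => x; rewrite !inE; case: eqVneq => [->|//];
    rewrite (negbTE us).
pose K' := K :\ t :\ (u |: t).
have utK : u |: t \in K by exact: coneK.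
have t_ut : t != u |: t.
  by apply: contraNneq ut => ->; rewrite setU11.
have KE : K = (u |: t) |: (t |: K').
  apply/setP => s; rewrite !inE.
  have [->|sut] := eqVneq s (u |: t); first by rewrite utK.
  by have [->|st] := eqVneq s t; first by rewrite tK.
have clK' : face_closed K'.
  move=> s s' ss'; rewrite !inE => /and3P[s'ut s't s'K].
  rewrite (clK _ _ ss' s'K) andbT; apply/andP; split.
    apply: contraNneq s'ut => E; rewrite E in ss'.
    have ts' : t \subset s' by rewrite (subset_trans _ ss')// subsetUr.
    by have [s'E|->] := ext s' s'K ts'; first by rewrite s'E eqxx in s't.
  apply: contraNneq s'ut => E; rewrite E in ss'.
  by have [s'E|->] := ext s' s'K ss'; first by rewrite s'E eqxx in s't.
rewrite [X in reduces _ _ X]KE; apply: reduces_pair => //.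
- apply: IHn => //.
    rewrite (leq_trans _ leKn)// proper_card// properE.
    apply/andP; split; first by apply/subsetP => s; rewrite !inE => /and3P[].
    by apply/subsetPn; exists t; rewrite // !inE eqxx andbF.
  move=> s; rewrite !inE => /and3P[sut st sK].
  rewrite coneK// andbT; apply/andP; split; last first.
    by apply: contraNneq ut => <-; rewrite setU11.
  apply: contra sut => /eqP E; have [us|us] := boolP (u \in s).
    by rewrite -E (setUidPr _)// sub1set.
  by move: st; rewrite -(setU1K us) E setU1K// eqxx.
- by rewrite !inE eqxx andbF.
- by rewrite !inE eqxx.
- by rewrite -KE.
Qed.

Definition cone_over (v : V) K : {set {set V}} := [set v |: s | s in K]%SET.

(** Reductions of the link of [v] act on the open star of [v] by adding [v] to
every simplex; this raises the size of critical simplices by one. *)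
Lemma reduces_star c (v : V) D K m :
  face_closed D -> (forall s, s \in D -> v \notin s) -> K \subset D ->
  reduces c set0 K m -> reduces c.+1 D (D :|: cone_over v K) m.
Proof.
move=> clD vD sKD redK; move: sKD.
have addE s K' : D :|: cone_over v (s |: K') = (v |: s) |: (D :|: cone_over v K').
  by rewrite /cone_over imsetU1 setUCA.
have notin s K' : v \notin s -> K' \subset D -> s \notin K' ->
    v |: s \notin D :|: cone_over v K'.
  move=> vs /subsetP sK'D sK'; rewrite inE negb_or; apply/andP; split.
    by apply/negP => /vD; rewrite setU11.
  apply/imsetP => -[t tK' E]; move/negP: sK'; apply.
  by rewrite -(setU1K vs) E setU1K// vD// sK'D.
have cl K' : face_closed K' -> K' \subset D -> face_closed (D :|: cone_over v K').
  move=> clK' /subsetP sK'D s t st /setUP[/(clD _ _ st)|/imsetP[r rK' tE]].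
    by rewrite inE => ->.
  rewrite inE; have [vs|vs] := boolP (v \in s).
    apply/orP; right; apply/imsetP; exists (s :\ v); last by rewrite setD1K.
    by apply: clK' rK'; rewrite subDset -tE.
  apply/orP; left; apply: (clD _ r); last exact: sK'D.
  apply/subsetP => x xs; have := subsetP st x xs.
  by rewrite tE => /setU1P[xv|//]; rewrite -xv xs in vs.
elim: redK => [|K' s w m' _ IH ws sK' wsK' clK|K' s m' _ IH sK' sc clK] sD.
- by rewrite /cone_over imset0 setU0; exact: reduces_refl.
- have K'D : K' \subset D.
    by apply: subset_trans sD; rewrite setUA subsetUr.
  have [sinD wsinD] : s \in D /\ w |: s \in D.
    by split; apply: (subsetP sD); rewrite !inE eqxx ?orbT.
  have vws := vD _ wsinD; have vs := vD _ sinD.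
  have wvs : w \notin v |: s.
    rewrite !inE negb_or ws andbT; apply: contraNneq vws => ->.
    by rewrite setU11.
  have vwE : v |: (w |: s) = w |: (v |: s) by rewrite setUCA.
  rewrite !addE vwE; apply: reduces_pair => //.
  + exact: IH.
  + exact: notin.
  + by rewrite -vwE; apply: notin.
  + by rewrite -vwE -!addE; exact: cl.
- have K'D : K' \subset D.
    by apply: subset_trans sD; rewrite subsetUr.
  have vs : v \notin s by apply: vD; apply: (subsetP sD); rewrite setU11.
  rewrite addE; apply: reduces_critical.
  + exact: IH.
  + exact: notin.
  + by rewrite cardsU1 vs sc.
  + by rewrite -addE; exact: cl.
Qed.

(** Simplices whose boundary lies in the final complex can be carried along. *)
Lemma collapses_add B K U : face_closed (B :|: U) ->
  (forall s, s \in U -> s \notin K) -> collapses B K ->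
  collapses (B :|: U) (K :|: U).
Proof.
move=> clBU UK colK; have cl K' : B \subset K' -> face_closed K' ->
    face_closed (K' :|: U).
  move=> BK' clK' s t st /setUP[/(clK' _ _ st)|tU]; first by rewrite inE => ->.
  have : s \in B :|: U by apply: clBU st _; rewrite inE tU orbT.
  by rewrite !inE => /orP[/(subsetP BK')->//|->]; rewrite orbT.
elim: colK UK => [_|K' s w colK' IH ws sK' wsK' clK UK]; first exact: collapses_refl.
have notin t : t \notin K' -> t \in (w |: s) |: (s |: K') -> t \notin K' :|: U.
  move=> tK' tK; rewrite inE negb_or tK' /=.
  by apply: contraL tK => /UK.
rewrite -!setUA; apply: collapses_pair => //.
- by apply: IH => t /UK; rewrite !inE !negb_or => /and3P[].
- by apply: notin => //; rewrite !inE eqxx orbT.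
- by apply: notin => //; rewrite !inE eqxx.
- rewrite !setUA -(setUA [set w |: s]%SET); apply: cl => //.
  by rewrite (subset_trans (collapses_sub colK'))// setUA subsetUr.
Qed.

(** Sorting the pairs of a reduction by size. Since all critical simplices have
size [c], every smaller simplex is paired; the pairs whose smaller member has
size less than [c] form a subcomplex [L] that still collapses to nothing, and the
other pairs can be removed first. The critical simplices then become facets
attached to [L]. *)
Lemma reduces_split c K m : reduces c set0 K m ->
  exists L C,
    [/\ collapses set0 L, face_closed L, collapses (L :|: C) K, #|C| = m
      & forall s, s \in C -> (s \notin L) && (#|s| == c)] /\
    [/\ forall s, s \in K -> #|s| < c -> s \in L & face_closed (L :|: C)].
Proof.
move=> redK.
suff [L [C [[colL clL colK cC CP] [LP _ clLC]]]] : exists L C,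
    [/\ collapses set0 L, face_closed L, collapses (L :|: C) K, #|C| = m
      & forall s, s \in C -> (s \notin L) && (#|s| == c)] /\
    [/\ forall s, s \in K -> #|s| < c -> s \in L,
        forall s, s \in L -> #|s| <= c & face_closed (L :|: C)].
  by exists L, C; split; split.
elim: redK => {K m} [|K s w m _ [L [C [[colL clL colK cC CP] [LP Lc clLC]]]]
    ws sK wsK clK|K s m _ [L [C [[colL clL colK cC CP] [LP Lc clLC]]]] sK sc clK].
- exists set0, set0; split; split=> //; rewrite ?setU0 ?cards0 //;
    try exact: collapses_refl; try exact: face_closed0;
    by move=> s; rewrite inE.
- have LCK := collapses_sub colK.
  have notLC t : t \notin K -> (t \notin L) && (t \notin C).
    by move=> tK; rewrite -negb_or -in_setU; apply: contra tK; exact: subsetP.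
  have small t : t \in (w |: s) |: (s |: K) -> #|t| < c -> #|s| < c ->
      t \in (w |: s) |: (s |: L).
    by rewrite !inE => /or3P[->|->|tK] tc sc; rewrite ?orbT// LP// !orbT.
  (* A pair with a large smaller member is removed before all the others; a pair
     with a small one joins [L]. *)
  have [sc|sc] := ltnP #|s| c; last first.
    exists L, C; split; split=> //.
      exact: collapses_pair.
    move=> t; rewrite !inE => /or3P[/eqP->|/eqP->|tK tc]; last exact: LP.
      by rewrite cardsU1 ws ltnNge (leq_trans sc)// leqnSn.
    by rewrite ltnNge sc.
  pose U : {set {set V}} := [set w |: s; s].
  have addU M : (w |: s) |: (s |: M) = M :|: U.
    by rewrite setUA setUC.
  have Uc t : t \in U -> #|t| <= c.
    by rewrite !inE => /orP[]/eqP->//; rewrite ?cardsU1 ?ws//; exact: ltnW.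
  have sizeU M : face_closed M ->
      (forall t, t \in K -> #|t| < c -> t \in M) -> face_closed (M :|: U).
    move=> clM KM t r tr /setUP[/(clM _ _ tr)|rU]; first by rewrite inE => ->.
    have [->|tNr] := eqVneq t r; first by rewrite inE rU orbT.
    have tc : #|t| < c.
      apply: leq_trans (Uc _ rU); rewrite proper_card// properEneq tNr.
      exact: tr.
    have : t \in K :|: U by rewrite -addU; apply: clK tr _; rewrite addU inE rU orbT.
    by case/setUP => [/KM/(_ tc) tM|tU]; apply/setUP; [left|right].
  have UK t : t \in U -> t \notin K by rewrite !inE => /orP[]/eqP->.
  have clLU : face_closed (L :|: U) by exact: sizeU.
  have clLCU : face_closed ((L :|: C) :|: U).
    by apply: sizeU => // t tK tc; rewrite inE LP.
  exists (L :|: U), C; rewrite addU; split; split=> //.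
  + rewrite -addU; apply: collapses_pair; rewrite ?addU//.
      by have /andP[] := notLC _ sK.
    by have /andP[] := notLC _ wsK.
  + rewrite setUAC; exact: collapses_add.
  + move=> t tC; have /andP[tL ->] := CP t tC; rewrite andbT inE negb_or tL /=.
    by apply: contraL tC => /UK/notLC/andP[].
  + move=> t; rewrite !inE => /orP[tK tc|/orP[]->]; rewrite ?orbT//.
    by rewrite LP.
  + by move=> t /setUP[/Lc|/Uc].
  + by rewrite setUAC.
- have LCK := collapses_sub colK.
  have notLC : (s \notin L) && (s \notin C).
    by rewrite -negb_or -in_setU; apply: contra sK; exact: subsetP.
  have clLCs : face_closed ((L :|: C) :|: [set s]).
    move=> t r tr; rewrite in_setU in_set1 => /orP[/(clLC _ _ tr) tLC|/eqP rs].
      by apply/setUP; left.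
    rewrite rs in tr; have [->|tNs] := eqVneq t s; first by rewrite !inE eqxx orbT.
    have tc : #|t| < c by rewrite -sc proper_card// properEneq tNs.
    have : t \in s |: K by apply: clK tr _; rewrite setU11.
    by rewrite !inE (negbTE tNs) => /= tK; rewrite LP.
  exists L, (s |: C); split; split=> //.
  + rewrite -(setUC C) setUA (setUC [set s]); apply: collapses_add => //.
    by move=> t; rewrite inE => /eqP->.
  + by rewrite cardsU1 cC; case/andP: notLC => _ ->.
  + move=> t /setU1P[->|/CP//]; rewrite sc eqxx andbT.
    by case/andP: notLC.
  + move=> t /setU1P[->|]; last exact: LP.
    by rewrite sc ltnn.
  + by rewrite -(setUC C) setUA.
Qed.

End Morse.

(** * Matching trees of graphs *)

(** [m] critical independent sets of size [c] are left in the subgraph induced on [A].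
An isolated vertex [u] matches everything by being added or removed. Splitting at [v],
[A1] is [A] without [v] and [A2] is [A] without the closed neighbourhood of [v]; a
critical set of [A2] is completed by [v], whence the shift of the sizes. *)
Inductive matching_tree (T : Type) (e : T -> T -> bool) :
    (T -> bool) -> nat -> nat -> Prop :=
| tree_empty A : (forall x, A x = false) -> matching_tree e A 0 1
| tree_isolated (A : T -> bool) u c : A u ->
    (forall x, A x -> e u x = false) -> matching_tree e A c 0
| tree_split (A A1 A2 : T -> bool) v c a b : A v ->
    (forall x, A1 x -> A x /\ x <> v) ->
    (forall x, A x -> A1 x \/ x = v) ->
    (forall x, A2 x = A1 x && ~~ e v x) ->
    matching_tree e A1 c.+1 a -> matching_tree e A2 c b ->
    matching_tree e A c.+1 (a + b).

Section TreeSound.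
Import mathcomp.boot.fintype mathcomp.boot.finset.
Variables (V : finType) (G : simple_graph V).

Definition independent_in (A : V -> bool) : {set {set V}} :=
  [set s in independent_sets G | [forall x in s, A x]].

Lemma independent_inP (A : V -> bool) (s : {set V}) :
  reflect ((forall x, x \in s -> A x) /\
           (forall x y, x \in s -> y \in s -> G x y = false))
    (s \in independent_in A).
Proof.
rewrite 2!inE; apply: (iffP andP) => [[/forall_inP iG /forall_inP sA]|[sA iG]].
  split=> // x y xs ys; have /forall_inP/(_ y ys) := iG x xs.
  exact: negbTE.
split; last exact/forall_inP.
by apply/forall_inP => x xs; apply/forall_inP => y ys; rewrite iG.
Qed.

Lemma independent_in_closed A : face_closed (independent_in A).
Proof.
move=> s t /subsetP st /independent_inP[tA tG].
by apply/independent_inP; split=> [x /st /tA|x y /st xt /st yt] //; exact: tG.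
Qed.

(** In the split case, first remove the simplices containing [v], following the
reduction of its link, then reduce the complex of [A1]. *)
Lemma matching_tree_reduces A c m : matching_tree G A c m ->
  reduces c set0 (independent_in A) m.
Proof.
elim=> {A c m} [A A0|A u c Au uA|A A1 A2 v c a b Av A1A AA1 A2E _ IH1 _ IH2].
- have -> : independent_in A = set0 |: set0.
    apply/setP => s; rewrite in_setU1 [X in _ || X]inE orbF.
    apply/independent_inP/eqP => [[sA _]|->]; last first.
      by split=> [x|x y]; rewrite inE.
    by apply/setP => x; rewrite inE; apply/negP => /sA; rewrite A0.
  apply: reduces_critical; rewrite ?inE ?cards0//; first exact: reduces_refl.
  move=> s t; rewrite setU0 !inE => /[swap] /eqP->.
  by rewrite subset0.
- apply: (@cone_reduces _ _ _ u); first exact: independent_in_closed.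
  move=> s /independent_inP[sA sG]; apply/independent_inP; split.
    by move=> x /setU1P[->//|/sA].
  move=> x y /setU1P[->|xs] /setU1P[->|ys]; rewrite ?adj_irr//.
  - by rewrite uA// sA.
  - by rewrite adj_sym uA// sA.
  - exact: sG.
- have -> : independent_in A =
      independent_in A1 :|: cone_over v (independent_in A2).
    apply/setP => s; rewrite in_setU; apply/idP/orP.
    + move=> /independent_inP[sA sG]; have [vs|vs] := boolP (v \in s).
        right; apply/imsetP; exists (s :\ v); last by rewrite setD1K.
        apply/independent_inP; split=> [x|x y]; rewrite !inE.
          move=> /andP[xv xs]; rewrite A2E sG// andbT.
          by have [//|E] := AA1 x (sA x xs); rewrite E eqxx in xv.
        by move=> /andP[_ xs] /andP[_ ys]; exact: sG.
      left; apply/independent_inP; split=> // x xs.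
      by have [//|E] := AA1 x (sA x xs); rewrite E (negbTE vs) in xs.
    + move=> [/independent_inP[sA sG]|/imsetP[t /independent_inP[tA tG] ->]].
        by apply/independent_inP; split=> // x /sA /A1A[].
      have tA1 x : x \in t -> A1 x /\ G v x = false.
        by move=> /tA; rewrite A2E => /andP[? /negbTE].
      apply/independent_inP; split.
        by move=> x /setU1P[->//|/tA1[/A1A[]]].
      move=> x y /setU1P[->|xt] /setU1P[->|yt]; rewrite ?adj_irr//.
      * by have [] := tA1 y yt.
      * by rewrite adj_sym; have [] := tA1 x xt.
      * exact: tG.
  rewrite addnC; apply: (reduces_trans _ IH1).
  apply: reduces_star => //; first exact: independent_in_closed.
  + by move=> s /independent_inP[sA _]; apply/negP => /sA/A1A[].
  + apply/subsetP => s /independent_inP[sA sG]; apply/independent_inP; split=> //.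
    by move=> x /sA; rewrite A2E => /andP[].
Qed.

End TreeSound.

Section TreeImage.
Variables (T U : Type) (e : T -> T -> bool) (f : U -> U -> bool) (g : T -> U).

(** Matching trees only see the induced subgraph, so they are carried along by
isomorphisms of induced subgraphs. *)
Lemma matching_tree_image (A : T -> bool) (B : U -> bool) c m :
  (forall x y, A x -> A y -> g x = g y -> x = y) ->
  (forall x y, A x -> A y -> f (g x) (g y) = e x y) ->
  (forall y, B y <-> exists2 x, A x & g x = y) ->
  matching_tree e A c m -> matching_tree f B c m.
Proof.
move=> + + + tA; elim: tA B => {A c m} [A A0|A u c Au uA|A A1 A2 v c a b Av A1A AA1
    A2E _ IH1 _ IH2] B ginj gadj BP.
- apply: tree_empty => y; apply/negP => /BP[x].
  by rewrite A0.
- apply: (@tree_isolated _ _ _ (g u)); first by apply/BP; exists u.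
  by move=> y /BP[x Ax <-]; rewrite gadj// uA.
- have A12 x : A2 x -> A1 x by rewrite A2E => /andP[].
  have AA x : A1 x -> A x by move=> /A1A[].
  pose B1 y := B y && ~~ `[< y = g v >].
  have B1P y : B1 y <-> exists2 x, A1 x & g x = y.
    split=> [/andP[/BP[x Ax <-]] /asboolP gxv|[x A1x <-]].
      by exists x => //; have [//|E] := AA1 x Ax; rewrite E in gxv.
    have [Ax xv] := A1A x A1x; apply/andP; split; first by apply/BP; exists x.
    by apply/asboolP => /ginj E; apply: xv; exact: E.
  pose B2 y := B1 y && ~~ f (g v) y.
  apply: (@tree_split _ _ _ B1 B2 (g v)).
  + by apply/BP; exists v.
  + by move=> y /andP[By /asboolP].
  + move=> y By; have [E|E] := pselect (y = g v); first by right.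
    by left; apply/andP; split=> //; apply/asboolP.
  + by [].
  + by apply: IH1 => // x y /AA Ax /AA Ay; [exact: ginj|exact: gadj].
  + apply: IH2 => [x y /A12/AA Ax /A12/AA Ay|x y /A12/AA Ax /A12/AA Ay|y].
    * exact: ginj.
    * exact: gadj.
    * split=> [/andP[/B1P[x A1x <-]]|[x A2x <-]].
        by rewrite (gadj _ _ Av (AA x A1x)) => vx; exists x; rewrite // A2E A1x.
      apply/andP; split; first by apply/B1P; exists x => //; exact: A12.
      by move: (A2x); rewrite A2E (gadj _ _ Av (AA x (A12 x A2x))) => /andP[].
Qed.

End TreeImage.

(** A vertex [v] whose neighbourhood contains that of some [u] off [v] can be
removed: in the link of [v], the vertex [u] is isolated. *)
Lemma matching_tree_fold (T : Type) (e : T -> T -> bool) (A A1 : T -> bool)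
    u v c m : A u -> u <> v -> e v u = false ->
  (forall x, A x -> e u x -> e v x) ->
  (forall x, A1 x -> A x /\ x <> v) -> (forall x, A x -> A1 x \/ x = v) ->
  matching_tree e A1 c.+1 m -> matching_tree e A c.+1 m.
Proof.
move=> Au uv evu uP A1A AA1 t1; have [Av|Av] := boolP (A v); last first.
  have -> : A = A1.
    apply/funext => x; apply/idP/idP => [Ax|/A1A[]//].
    by have [//|E] := AA1 x Ax; rewrite E (negbTE Av) in Ax.
  exact: t1.
rewrite -[m]addn0.
apply: (@tree_split _ _ _ A1 (fun x => A1 x && ~~ e v x) v) => //.
apply: (@tree_isolated _ _ _ u).
  by rewrite evu andbT; have [] := AA1 u Au.
move=> x /andP[/A1A[Ax _]]; apply: contraNF; exact: uP.
Qed.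

(** Split at [v]: without [v] the vertex [u] is isolated, and the link of [v] is the
complex of the rest of the graph. *)
Lemma matching_tree_edge (T : Type) (e : T -> T -> bool) (A A1 : T -> bool)
    u v c m : A u -> A v -> u <> v -> e v u -> e u u = false ->
  (forall x, A x -> e u x -> x = v) -> (forall x, A x -> e v x -> x = u) ->
  (forall x, A1 x -> [/\ A x, x <> u & x <> v]) ->
  (forall x, A x -> [\/ A1 x, x = u | x = v]) ->
  matching_tree e A1 c m -> matching_tree e A c.+1 m.
Proof.
move=> Au Av uv evu euu uP vP A1A AA1 t1.
pose Av' x := A x && ~~ `[< x = v >].
rewrite -[m]add0n; apply: (@tree_split _ _ _ Av' A1 v) => //.
- by move=> x /andP[? /asboolP].
- move=> x Ax; have [E|E] := pselect (x = v); first by right.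
  by left; rewrite /Av' Ax; apply/asboolP.
- move=> x; apply/idP/andP => [/A1A[Ax xu xv]|[/andP[Ax /asboolP xv] vx]].
    rewrite /Av' Ax; split; first exact/asboolP.
    by apply/negP => /(vP _ Ax).
  by have [//|E|//] := AA1 x Ax; rewrite E evu in vx.
- apply: (@tree_isolated _ _ _ u); first by rewrite /Av' Au; apply/asboolP.
  move=> x /andP[Ax /asboolP xv]; apply/negP => /(uP _ Ax); exact: xv.
Qed.

(** * Induced subgraphs of the strip of width four *)

(** An induced subgraph of the infinite grid is given by the list of its columns,
each column listing the vertices present. *)
Definition strip := seq (seq bool).

Definition present (s : strip) (x : nat * nat) : bool :=
  nth false (nth [::] s x.1) x.2.

Definition neighbours (x : nat * nat) : seq (nat * nat) :=
  [:: (x.1.+1, x.2); (x.1, x.2.+1)]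
    ++ (if x.1 is i.+1 then [:: (i, x.2)] else [::])
    ++ (if x.2 is j.+1 then [:: (x.1, j)] else [::]).

Definition lattice_adj (x y : nat * nat) : bool := y \in neighbours x.

Lemma lattice_adjE x y : lattice_adj x y =
  ((x.1 == y.1) && ((x.2.+1 == y.2) || (y.2.+1 == x.2))) ||
  ((x.2 == y.2) && ((x.1.+1 == y.1) || (y.1.+1 == x.1))).
Proof.
case: x y => [i j] [k l]; rewrite /lattice_adj /neighbours !mem_cat !inE /=.
case: i => [|i]; case: j => [|j]; rewrite ?inE ?xpair_eqE; lia.
Qed.

Lemma lattice_adj_irr x : lattice_adj x x = false.
Proof. by rewrite lattice_adjE; lia. Qed.

(** Removing a vertex beyond the listed columns pads the list, which does not change
the vertices present. *)
Definition remove (x : nat * nat) (s : strip) : strip :=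
  set_nth [::] s x.1 (set_nth false (nth [::] s x.1) x.2 false).

Lemma present_remove x s y : present (remove x s) y = present s y && (y != x).
Proof.
rewrite /present /remove nth_set_nth /= -pair_eqE /=.
case: eqVneq => [->|]; last by rewrite andbT.
rewrite nth_set_nth /=; case: eqVneq => [->|]; last by rewrite andbT.
by rewrite andbF.
Qed.

Lemma present_removes xs s y :
  present (foldr remove s xs) y = present s y && (y \notin xs).
Proof.
elim: xs => [|x xs IH]; first by rewrite andbT.
by rewrite /= present_remove IH inE negb_or -andbA (andbC (y \notin xs)).
Qed.

(** The conditions of [matching_tree_fold] and [matching_tree_edge] concern a few
neighbours only, so they are decided by computation on the first columns of a strip,
the others remaining symbolic. *)
Definition foldable (s : strip) (u v : nat * nat) : bool :=
  [&& present s u, u != v, ~~ lattice_adj v u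
    & all (fun x => present s x ==> lattice_adj v x) (neighbours u)].

(** An operation [(v, u)] removes [v] because of [u]. *)
Fixpoint folds (ops : seq ((nat * nat) * (nat * nat))) (s : strip) :
    option strip :=
  if ops is (v, u) :: ops' then
    if foldable s u v then folds ops' (remove v s) else None
  else Some s.

Definition isolated_edge (s : strip) (u v : nat * nat) : bool :=
  [&& present s u, present s v, lattice_adj v u,
      all (fun x => present s x ==> (x == v)) (neighbours u)
    & all (fun x => present s x ==> (x == u)) (neighbours v)].

Fixpoint edges (ops : seq ((nat * nat) * (nat * nat))) (s : strip) :
    option strip :=
  if ops is (u, v) :: ops' then
    if isolated_edge s u v then edges ops' (remove u (remove v s)) else None
  else Some s.

Local Notation tree s := (matching_tree lattice_adj (present s)).

Lemma tree_folds ops s s' c m :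
  folds ops s = Some s' -> tree s' c.+1 m -> tree s c.+1 m.
Proof.
elim: ops s => [|[v u] ops IH] s /=; first by move=> [->].
case: ifP => // /and4P[su uv vu /allP uP] opsE t; have {}t := IH _ opsE t.
apply: (@matching_tree_fold _ _ _ (present (remove v s)) u v) => //.
- exact/eqP.
- exact: negbTE.
- by move=> x sx /uP; rewrite sx.
- by move=> x; rewrite present_remove => /andP[? /eqP].
- by move=> x sx; rewrite present_remove sx; case: eqVneq; [right|left].
Qed.

Lemma tree_edges ops s s' c m :
  edges ops s = Some s' -> tree s' c m -> tree s (size ops + c) m.
Proof.
elim: ops s => [|[u v] ops IH] s /=; first by move=> [->].
case: ifP => // /and5P[su sv vu /allP uP /allP vP] opsE t.
have {}t := IH _ opsE t.
apply: (@matching_tree_edge _ _ _ (present (remove u (remove v s))) u v) => //.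
- by move=> E; rewrite E lattice_adj_irr in vu.
- exact: lattice_adj_irr.
- by move=> x sx /uP; rewrite sx => /eqP.
- by move=> x sx /vP; rewrite sx => /eqP.
- by move=> x; rewrite !present_remove => /andP[/andP[? /eqP ?] /eqP ?].
- move=> x sx; rewrite !present_remove sx /=.
  case: eqVneq => [->|_]; first by constructor 3.
  by case: eqVneq; [constructor 2|constructor 1].
Qed.

Lemma tree_split_strip v s c a b : present s v ->
  tree (remove v s) c.+1 a -> tree (foldr remove s (v :: neighbours v)) c b ->
  tree s c.+1 (a + b).
Proof.
move=> sv ta tb.
apply: (@tree_split _ _ _ (present (remove v s))
  (present (foldr remove s (v :: neighbours v))) v) => //.
- by move=> x; rewrite present_remove => /andP[? /eqP].
- by move=> x sx; rewrite present_remove sx; case: eqVneq; [right|left].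
- by move=> x; rewrite present_removes present_remove inE negb_or andbA.
Qed.

Lemma tree_nil : tree [::] 0 1.
Proof. by apply: tree_empty => -[i j]; rewrite /present /= !nth_nil. Qed.

Lemma tree_isolated_strip s u c :
  present s u -> all (fun x => ~~ present s x) (neighbours u) -> tree s c 0.
Proof.
move=> su /allP uP; apply: (@tree_isolated _ _ _ u) => // x sx.
by apply/negP => /uP; rewrite sx.
Qed.

(** Empty columns can be dropped, by translation. *)
Lemma tree_shift z s c m : z = nseq (size z) false ->
  tree s c m -> tree (z :: s) c m.
Proof.
move=> z0; apply: (@matching_tree_image _ _ _ _ (fun x => (x.1.+1, x.2))).
- by move=> [i j] [k l] _ _ /= [-> ->].
- by move=> x y _ _; rewrite !lattice_adjE /= !eqSS.
- move=> [[|i] j]; rewrite /present /=; last first.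
    by split=> [?|[[k l] /= ? [<- <-]//]]; exists (i, j).
  by rewrite z0 nth_nseq if_same; split=> // -[[k l] /=].
Qed.

(** * Critical simplices of the grid *)

Definition full (n : nat) : strip := nseq n [:: true; true; true; true].

Definition notched (c : seq bool) (n : nat) : strip :=
  if n is n'.+1 then c :: full n' else [::].

Definition rows13 := [:: true; false; true; false].
Definition rows24 := [:: false; true; false; true].
Definition rows234 := [:: false; true; true; true].
Definition rows134 := [:: true; false; true; true].
Definition rows124 := [:: true; true; false; true].
Definition rows123 := [:: true; true; true; false].

Lemma fullS n : full n.+1 = [:: true; true; true; true] :: full n.
Proof. by []. Qed.

Local Ltac fold_by ops :=
  apply: (@tree_folds ops); first by cbv -[full]; reflexivity.
Local Ltac edge_by ops :=
  apply: (@tree_edges ops); first by cbv -[full]; reflexivity.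
Local Ltac drop_columns := do ?[apply: tree_shift; first by []].

Local Open Scope nat_scope.

(** The four remaining vertices of the first two columns in the rows two and four
become two isolated edges, and the third column is left with the two other rows. The
shortest strip is treated apart because its third column does not exist; the same
happens in the next lemmas. *)
Lemma tree_rows24 n c m :
  tree (notched rows13 n) c m -> tree (notched rows24 n.+2) c.+2 m.
Proof.
move=> t; rewrite /notched !fullS.
case: n t => [|n] t; rewrite ?fullS.
  fold_by [:: ((1, 0), (0, 1)); ((1, 2), (0, 1))].
  edge_by [:: ((0, 1), (1, 1)); ((0, 3), (1, 3))].
  by drop_columns.
fold_by [:: ((1, 0), (0, 1)); ((1, 2), (0, 1)); ((2, 1), (0, 1)); ((2, 3), (0, 3))].
edge_by [:: ((0, 1), (1, 1)); ((0, 3), (1, 3))].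
by drop_columns.
Qed.

Lemma tree_rows13 n c m :
  tree (notched rows24 n) c m -> tree (notched rows13 n.+2) c.+2 m.
Proof.
move=> t; rewrite /notched !fullS.
case: n t => [|n] t; rewrite ?fullS.
  fold_by [:: ((1, 1), (0, 0)); ((1, 3), (0, 2))].
  edge_by [:: ((0, 0), (1, 0)); ((0, 2), (1, 2))].
  by drop_columns.
fold_by [:: ((1, 1), (0, 0)); ((1, 3), (0, 2)); ((2, 0), (0, 0)); ((2, 2), (0, 2))].
edge_by [:: ((0, 0), (1, 0)); ((0, 2), (1, 2))].
by drop_columns.
Qed.

(** The top two vertices of the first column and the pair in row four become isolated
edges; nothing else of the first two columns survives. *)
Lemma tree_rows124 n c m :
  tree (notched rows123 n) c m -> tree (notched rows124 n.+2) c.+2 m.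
Proof.
move=> t; rewrite /notched !fullS.
case: n t => [|n] t; rewrite ?fullS.
  fold_by [:: ((1, 2), (0, 3)); ((1, 1), (0, 0)); ((1, 0), (0, 1))].
  edge_by [:: ((0, 3), (1, 3)); ((0, 0), (0, 1))].
  by drop_columns.
fold_by [:: ((1, 2), (0, 3)); ((2, 3), (0, 3)); ((1, 1), (0, 0)); ((1, 0), (0, 1))].
edge_by [:: ((0, 3), (1, 3)); ((0, 0), (0, 1))].
by drop_columns.
Qed.

Lemma tree_rows134 n c m :
  tree (notched rows234 n) c m -> tree (notched rows134 n.+2) c.+2 m.
Proof.
move=> t; rewrite /notched !fullS.
case: n t => [|n] t; rewrite ?fullS.
  fold_by [:: ((1, 1), (0, 0)); ((1, 2), (0, 3)); ((1, 3), (0, 2))].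
  edge_by [:: ((0, 0), (1, 0)); ((0, 3), (0, 2))].
  by drop_columns.
fold_by [:: ((1, 1), (0, 0)); ((2, 0), (0, 0)); ((1, 2), (0, 3)); ((1, 3), (0, 2))].
edge_by [:: ((0, 0), (1, 0)); ((0, 3), (0, 2))].
by drop_columns.
Qed.

(** Splitting at the middle vertex of the first column: without it, two isolated edges
appear as in [tree_rows24]; its link is the strip of the remaining columns, whose first
one has lost the vertex folded away before. *)
Lemma tree_rows234 n c a b :
  tree (notched rows13 n) c a -> tree (notched rows124 n.+1) c.+1 b ->
  tree (notched rows234 n.+2) c.+2 (a + b).
Proof.
move=> ta tb; rewrite /notched !fullS.
fold_by [:: ((1, 2), (0, 1))].
apply: (@tree_split_strip (0, 2)) => //; last by drop_columns.
case: n ta {tb} => [|n] ta; rewrite ?fullS.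
  fold_by [:: ((1, 0), (0, 1))].
  edge_by [:: ((0, 1), (1, 1)); ((0, 3), (1, 3))].
  by drop_columns.
fold_by [:: ((1, 0), (0, 1)); ((2, 1), (0, 1)); ((2, 3), (0, 3))].
edge_by [:: ((0, 1), (1, 1)); ((0, 3), (1, 3))].
by drop_columns.
Qed.

Lemma tree_rows123 n c a b :
  tree (notched rows24 n) c a -> tree (notched rows134 n.+1) c.+1 b ->
  tree (notched rows123 n.+2) c.+2 (a + b).
Proof.
move=> ta tb; rewrite /notched !fullS.
fold_by [:: ((1, 1), (0, 2))].
apply: (@tree_split_strip (0, 1)) => //; last by drop_columns.
case: n ta {tb} => [|n] ta; rewrite ?fullS.
  fold_by [:: ((1, 3), (0, 2))].
  edge_by [:: ((0, 2), (1, 2)); ((0, 0), (1, 0))].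
  by drop_columns.
fold_by [:: ((1, 3), (0, 2)); ((2, 2), (0, 2)); ((2, 0), (0, 0))].
edge_by [:: ((0, 2), (1, 2)); ((0, 0), (1, 0))].
by drop_columns.
Qed.

(** Two foldings at the corners empty the middle of the second column, and the strip
is split at the second vertex of the first one. Without it, two isolated edges and a
strip with a missing corner remain; its link consists of three isolated edges and of
a strip that starts at the fifth column. *)
Lemma tree_full n c a b :
  tree (notched rows234 n.+2) c.+2 a -> tree (notched rows124 n) c b ->
  tree (full n.+4) c.+4 (a + b).
Proof.
move=> ta tb; rewrite !fullS.
fold_by [:: ((1, 1), (0, 0)); ((1, 2), (0, 3))].
apply: (@tree_split_strip (0, 1)) => //.
  fold_by [:: ((2, 0), (0, 0)); ((1, 3), (0, 2))].
  edge_by [:: ((0, 0), (1, 0)); ((0, 2), (0, 3))].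
  by drop_columns.
case: n tb {ta} => [|n] tb; rewrite ?fullS.
  fold_by [:: ((2, 3), (0, 3)); ((2, 1), (1, 0)); ((3, 0), (1, 0));
              ((3, 1), (2, 2)); ((3, 3), (2, 2))].
  edge_by [:: ((0, 3), (1, 3)); ((1, 0), (2, 0)); ((2, 2), (3, 2))].
  by drop_columns.
fold_by [:: ((2, 3), (0, 3)); ((2, 1), (1, 0)); ((3, 0), (1, 0));
            ((3, 1), (2, 2)); ((3, 3), (2, 2)); ((4, 2), (2, 2))].
edge_by [:: ((0, 3), (1, 3)); ((1, 0), (2, 0)); ((2, 2), (3, 2))].
by drop_columns.
Qed.

Lemma tree_two_rows n : tree (notched rows13 n) n (~~ odd n) /\
  tree (notched rows24 n) n (~~ odd n).
Proof.
have [k] := ubnP n; elim: k => // k IH in n *.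
case: n => [|[|n]] nk; first by split; exact: tree_nil.
  by split; [apply: (@tree_isolated_strip _ (0, 0))
            |apply: (@tree_isolated_strip _ (0, 1))].
have [IH13 IH24] := IH n (ltnW nk).
by rewrite /= negbK; split; [exact: tree_rows13|exact: tree_rows24].
Qed.

(** The number of critical simplices of a strip with one corner missing. *)
Fixpoint notched_count (n : nat) : nat :=
  if n is n'.+3 then odd n' + notched_count n' else 1.

Lemma tree_three_rows n : tree (notched rows123 n) n (notched_count n) /\
  tree (notched rows234 n) n (notched_count n).
Proof.
have [k] := ubnP n; elim: k => // k IH in n *.
case: n => [|[|[|n]]] nk; first by split; exact: tree_nil.
- split; rewrite -[notched_count 1]/(0 + 1).
    apply: (@tree_split_strip (0, 1)) => //; last by drop_columns; exact: tree_nil.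
    exact: (@tree_isolated_strip _ (0, 0)).
  apply: (@tree_split_strip (0, 2)) => //; last by drop_columns; exact: tree_nil.
  exact: (@tree_isolated_strip _ (0, 1)).
- split; rewrite -[notched_count 2]/(1 + 0).
    apply: (@tree_rows123 0 0 1 0); first exact: tree_nil.
    exact: (@tree_isolated_strip _ (0, 0)).
  apply: (@tree_rows234 0 0 1 0); first exact: tree_nil.
  exact: (@tree_isolated_strip _ (0, 3)).
- have [IH123 IH234] := IH n (ltnW (ltnW nk)).
  have [t13 t24] := tree_two_rows n.+1.
  rewrite oddS negbK in t13 t24.
  rewrite -[notched_count n.+3]/(odd n + notched_count n).
  by split; [apply: (tree_rows123 t24); exact: tree_rows134
            |apply: (tree_rows234 t13); exact: tree_rows124].
Qed.

Lemma notched_count_add6 n k :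
  notched_count (6 * k + n) = k + notched_count n.
Proof.
elim: k => [//|k IH]; rewrite mulnS -addnA [LHS]/= IH.
by case: (odd _); lia.
Qed.

Lemma tree_grid n k l : 0 < n -> l <= 5 -> n = 6 * k + l ->
  tree (full n) n
    (match l with 1 => 2 * k | 4 => 2 * k + 2 | _ => 2 * k + 1 end).
Proof.
move=> n0 l5 nE.
have [n6|n6] := leqP 6 n.
  case: k nE => [|k] nE; first by lia.
  have [m mE] : exists m, n = m.+3.+3 by exists (n - 6); lia.
  have mE' : m = 6 * k + l by lia.
  have [_ t234] := tree_three_rows m.+4.
  have [t123 _] := tree_three_rows m.
  have := tree_full t234 (tree_rows124 t123).
  rewrite mE; congr (matching_tree _ _ _ _).
  have -> : m.+4 = 6 * k + l.+4 by lia.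
  rewrite mE' !notched_count_add6.
  by case: l l5 {nE mE mE'} => [|[|[|[|[|[|l]]]]]] //= _; lia.
have k0 : k = 0 by lia.
have {nE} -> : l = n by lia.
rewrite k0; move: n0 n6; do 6?[case: n => [|n]] => // _ _.
- fold_by [:: ((0, 2), (0, 0))].
  exact: (@tree_isolated_strip _ (0, 3)).
- rewrite -[X in tree _ _ X]/(1 + 0).
  fold_by [:: ((1, 1), (0, 0)); ((1, 2), (0, 3))].
  apply: (@tree_split_strip (0, 1)) => //.
    fold_by [:: ((1, 3), (0, 2))].
    edge_by [:: ((0, 0), (1, 0)); ((0, 2), (0, 3))].
    by drop_columns; exact: tree_nil.
  exact: (@tree_isolated_strip _ (1, 0)).
- rewrite -[X in tree _ _ X]/(1 + 0).
  fold_by [:: ((1, 1), (0, 0)); ((1, 2), (0, 3))].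
  apply: (@tree_split_strip (0, 1)) => //.
    fold_by [:: ((2, 0), (0, 0)); ((1, 3), (0, 2))].
    edge_by [:: ((0, 0), (1, 0)); ((0, 2), (0, 3))].
    by drop_columns; exact: (tree_three_rows 1).2.
  fold_by [:: ((2, 3), (0, 3)); ((2, 1), (1, 0))].
  exact: (@tree_isolated_strip _ (2, 2)).
- exact: (@tree_full 0 0 1 1 (tree_three_rows 2).2 tree_nil).
- apply: (@tree_full 1 1 1 0 (tree_three_rows 3).2).
  exact: (@tree_isolated_strip _ (0, 3)).
Qed.

Section Grid.
Import mathcomp.boot.fintype mathcomp.boot.finset.

Lemma present_full n x : present (full n) x = (x.1 < n) && (x.2 < 4).
Proof.
rewrite /present nth_nseq; case: ifP => _; last by rewrite nth_nil.
by case: x => i [|[|[|[|[|j]]]]].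
Qed.

Lemma grid_reduces n k l : 0 < n -> l <= 5 -> n = 6 * k + l ->
  reduces n set0 (independent_sets (grid_graph n 4))
    (match l with 1 => 2 * k | 4 => 2 * k + 2 | _ => 2 * k + 1 end).
Proof.
move=> n0 l5 nE; have := tree_grid n0 l5 nE.
set m := (X in matching_tree _ _ _ X) => t.
have -> : independent_sets (grid_graph n 4) =
    independent_in (grid_graph n 4) (fun=> true).
  by apply/setP => s; rewrite [RHS]inE; case: (s \in _) => //=; apply/esym/forall_inP.
apply: matching_tree_reduces; case: n n0 {nE} t => [//|n] _ t.
apply: (matching_tree_image (g := fun x => (inord x.1 : 'I_n.+1, inord x.2 : 'I_4))) t.
- move=> [i j] [i' j']; rewrite !present_full /=.
  move=> /andP[Hi Hj] /andP[Hi' Hj'] /= [/(congr1 val) + /(congr1 val)].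
  by rewrite /= !inordK// => -> ->.
- move=> [i j] [i' j']; rewrite !present_full /=.
  move=> /andP[Hi Hj] /andP[Hi' Hj'].
  rewrite /grid_adj lattice_adjE /= !inordK//; lia.
- move=> [i j]; split=> // _; exists (val i, val j); last by rewrite /= !inord_val.
  by rewrite present_full /= !ltn_ord.
Qed.

End Grid.

Local Open Scope classical_set_scope.
Local Open Scope ring_scope.

(** * Continuous maps and homotopies *)

Lemma continuous_ptws (Z : topologicalType) (V : Type) (Y : topologicalType)
    (f : Z -> {ptws V -> Y}) :
  (forall v, continuous (fun z => f z v)) -> continuous f.
Proof.
move=> cf z; apply/cvg_sup => v.
move=> U [_ [[W oW <-]]] /= Wz /filterS; apply.
exact: (cf v z W (open_nbhs_nbhs (conj oW Wz))).
Qed.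

Lemma continuous_set_type (Z X : topologicalType) (A : set X)
    (f : Z -> set_type A) :
  continuous (fun z => \val (f z)) -> continuous f.
Proof. exact: continuous_comp_initial. Qed.

Definition to_set_type (X : Type) (A : set X) (x : X) (Ax : A x) : set_type A :=
  exist (fun y => y \in A) x (mem_set Ax).

Lemma continuous_val (X : topologicalType) (A : set X) :
  continuous (fun x : set_type A => \val x).
Proof. exact: initial_continuous. Qed.

Lemma continuous_pair (Z X Y : topologicalType) (f : Z -> X) (g : Z -> Y) :
  continuous f -> continuous g -> continuous (fun z => (f z, g z)).
Proof. by move=> cf cg z; apply: cvg_pair; [exact: cf|exact: cg]. Qed.

Lemma continuous_compose (X Y Z : topologicalType) (f : X -> Y) (g : Y -> Z) :
  continuous f -> continuous g -> continuous (fun x => g (f x)).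
Proof. by move=> cf cg x; apply: continuous_comp; [exact: cf|exact: cg]. Qed.

Lemma continuous_fst (X Y : topologicalType) : continuous (@fst X Y).
Proof. by move=> z; exact: cvg_fst. Qed.

Lemma continuous_snd (X Y : topologicalType) : continuous (@snd X Y).
Proof. by move=> z; exact: cvg_snd. Qed.

Section Real.
Variable R : realType.

Section RealFunctions.
Variable Z : topologicalType.
Implicit Types f g : Z -> R.

Lemma continuous_add f g : continuous f -> continuous g ->
  continuous (fun z => f z + g z).
Proof. by move=> cf cg z; apply: cvgD; [exact: cf|exact: cg]. Qed.

Lemma continuous_sub f g : continuous f -> continuous g ->
  continuous (fun z => f z - g z).
Proof. by move=> cf cg z; apply: cvgB; [exact: cf|exact: cg]. Qed.

Lemma continuous_mul f g : continuous f -> continuous g ->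
  continuous (fun z => f z * g z).
Proof. by move=> cf cg z; apply: cvgM; [exact: cf|exact: cg]. Qed.

Lemma continuous_inv f : continuous f -> (forall z, f z != 0) ->
  continuous (fun z => (f z)^-1).
Proof. by move=> cf f0 z; apply: cvgV; [exact: f0|exact: cf]. Qed.

Lemma continuous_minf f g : continuous f -> continuous g ->
  continuous (fun z => Num.min (f z) (g z)).
Proof. by move=> cf cg z; apply: continuous_min; [exact: cf|exact: cg]. Qed.

Lemma continuous_maxf f g : continuous f -> continuous g ->
  continuous (fun z => Num.max (f z) (g z)).
Proof. by move=> cf cg z; apply: continuous_max; [exact: cf|exact: cg]. Qed.

Lemma continuous_sum (I : Type) (r : seq I) (P : pred I) (f : I -> Z -> R) :
  (forall i, continuous (f i)) ->
  continuous (fun z => \sum_(i <- r | P i) f i z).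
Proof.
move=> cf; elim: r => [|i r IHr] z.
  by under eq_fun do rewrite big_nil; exact: cst_continuous.
under eq_fun do rewrite big_cons.
by case: (P i); [apply: continuous_add => //; exact: cf|exact: IHr].
Qed.

Lemma continuous_prod (I : Type) (r : seq I) (P : pred I) (f : I -> Z -> R) :
  (forall i, continuous (f i)) ->
  continuous (fun z => \prod_(i <- r | P i) f i z).
Proof.
move=> cf; elim: r => [|i r IHr] z.
  by under eq_fun do rewrite big_nil; exact: cst_continuous.
under eq_fun do rewrite big_cons.
by case: (P i); [apply: continuous_mul => //; exact: cf|exact: IHr].
Qed.

Lemma continuous_bigmin (I : Type) (r : seq I) (P : pred I) (x : Z -> R)
    (f : I -> Z -> R) : continuous x -> (forall i, continuous (f i)) ->
  continuous (fun z => \big[Num.min/x z]_(i <- r | P i) f i z).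
Proof.
move=> cx cf; elim: r => [|i r IHr] z.
  by under eq_fun do rewrite big_nil; exact: cx.
under eq_fun do rewrite big_cons.
by case: (P i); [apply: continuous_minf => //; exact: cf|exact: IHr].
Qed.

End RealFunctions.

Definition clamp (t : R) : R := Num.max 0 (Num.min t 1).

Lemma clamp_itv t : 0 <= clamp t <= 1.
Proof. by rewrite /clamp le_max lexx ge_max ler01 ge_min lexx orbT. Qed.

Lemma clamp_id t : 0 <= t <= 1 -> clamp t = t.
Proof. by case/andP => t0 t1; rewrite /clamp (min_idPl t1) (max_idPr t0). Qed.

Lemma continuous_clamp (Z : topologicalType) (f : Z -> R) :
  continuous f -> continuous (fun z => clamp (f z)).
Proof.
move=> cf; apply: continuous_maxf; first by move=> z; exact: cst_continuous.
by apply: continuous_minf => // z; exact: cst_continuous.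
Qed.

Section Homotopic.
Variables X Y : topologicalType.
Implicit Types f g h : X -> Y.

(** Reparametrizing by [clamp] makes a homotopy continuous for all real times, so
that homotopies can be treated as plain continuous maps. *)
Lemma homotopicP f g : homotopic R f g <->
  exists H : X * R -> Y,
    [/\ continuous H, forall x, H (x, 0) = f x & forall x, H (x, 1) = g x].
Proof.
split=> [[H [cH H0 H1]]|[H [cH H0 H1]]]; last first.
  by exists H; split => //; exact: continuous_subspaceT.
exists (fun p => H (p.1, clamp p.2)); split; last 2 first.
- by move=> x /=; rewrite clamp_id ?H0// lexx ler01.
- by move=> x /=; rewrite clamp_id ?H1// lexx ler01.
move/subspace_sigL_continuousP : cH => cH.
pose D : set (X * R) := [set: X] `*` `[0, 1].
have inD (p : X * R) : D (p.1, clamp p.2).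
  by split=> //=; rewrite in_itv/= clamp_itv.
pose c p := to_set_type (inD p).
have cc : continuous c.
  apply: continuous_set_type; apply: continuous_pair.
    exact: continuous_fst.
  by apply: continuous_clamp; exact: continuous_snd.
exact: (continuous_compose cc cH).
Qed.

Lemma homotopic_refl f : continuous f -> homotopic R f f.
Proof.
move=> cf; apply/homotopicP; exists (fun p => f p.1); split => //.
by apply: continuous_compose => //; exact: continuous_fst.
Qed.

Lemma homotopic_sym f g : homotopic R f g -> homotopic R g f.
Proof.
move=> /homotopicP[H [cH H0 H1]]; apply/homotopicP.
exists (fun p => H (p.1, 1 - p.2)); split; last 2 first.
- by move=> x; rewrite /= subr0 H1.
- by move=> x; rewrite /= subrr H0.
apply: (continuous_compose _ cH); apply: continuous_pair.
  exact: continuous_fst.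
apply: continuous_sub; first by move=> z; exact: cst_continuous.
exact: continuous_snd.
Qed.

End Homotopic.

Lemma paste (Z Y : topologicalType) (phi : Z -> R)
    (f : set_type [set z | phi z <= 0] -> Y)
    (g : set_type [set z | 0 <= phi z] -> Y) :
  continuous phi -> continuous f -> continuous g ->
  (forall x y, \val x = \val y -> f x = g y) ->
  exists h : Z -> Y, [/\ continuous h, forall x, h (\val x) = f x
    & forall y, h (\val y) = g y].
Proof.
move=> cphi cf cg fg.
pose A := [set z | phi z <= 0]; pose B := [set z | 0 <= phi z].
have AB z : A z + B z by case: (leP (phi z) 0) => [?|/ltW ?]; [left|right].
pose h z :=
  match AB z with inl a => f (to_set_type a) | inr b => g (to_set_type b) end.
have hf x : h (\val x) = f x.
  rewrite /h; case: (AB _) => [a|b]; first by congr f; exact: val_inj.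
  by apply/esym/fg.
have hg x : h (\val x) = g x.
  rewrite /h; case: (AB _) => [a|b]; last by congr g; exact: val_inj.
  by apply/fg.
exists h; split => //.
have [clA clB] : closed A /\ closed B.
  split; first exact: (closed_comp (fun z _ => cphi z) (@closed_le _ 0)).
  exact: (closed_comp (fun z _ => cphi z) (@closed_ge _ 0)).
have AB_T : A `|` B = [set: Z].
  by apply/seteqP; split=> z // _; have [|] := AB z; [left|right].
apply/continuous_subspace_setT; rewrite -AB_T.
apply: withinU_continuous => //; apply/subspace_sigL_continuousP.
  by rewrite (_ : sigL A h = f)//; apply/funext => x; exact: hf.
by rewrite (_ : sigL B h = g)//; apply/funext => x; exact: hg.
Qed.

Lemma homotopic_trans (X Y : topologicalType) (f g h : X -> Y) :
  homotopic R f g -> homotopic R g h -> homotopic R f h.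
Proof.
move=> /homotopicP[F [cF F0 F1]] /homotopicP[G [cG G0 G1]]; apply/homotopicP.
have c2 : continuous (fun p : X * R => 2 * p.2).
  by apply: continuous_mul; [move=> z; exact: cst_continuous|exact: continuous_snd].
pose phi (p : X * R) : R := 2 * p.2 - 1.
have cphi : continuous phi.
  by apply: continuous_sub => // z; exact: cst_continuous.
have [||p q pq|H [cH HF HG]] := paste
  (f := fun p : set_type [set p | phi p <= 0] =>
    F ((\val p).1, 2 * (\val p).2))
  (g := fun p : set_type [set p | 0 <= phi p] =>
    G ((\val p).1, phi (\val p))) cphi.
- apply: continuous_compose cF; apply: continuous_pair.
    by apply: continuous_compose; [exact: continuous_val|exact: continuous_fst].
  by apply: (continuous_compose (@continuous_val _ _) c2).
- apply: continuous_compose cG; apply: continuous_pair.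
    by apply: continuous_compose; [exact: continuous_val|exact: continuous_fst].
  by apply: (continuous_compose (@continuous_val _ _) cphi).
- have := set_valP p; have := set_valP q; rewrite /= -!pq /phi => q0 p0.
  have -> : 2 * (\val p).2 = 1 by lra.
  by rewrite subrr F1 G0.
have H0 x : [set p | phi p <= 0] (x, 0) by rewrite /= /phi /=; lra.
have H1 x : [set p | 0 <= phi p] (x, 1) by rewrite /= /phi /=; lra.
exists H; split => // x.
  by rewrite (HF (to_set_type (H0 x)))/= mulr0 F0.
by rewrite (HG (to_set_type (H1 x)))/= /phi/= mulr1 (_ : 2 - 1 = 1) ?G1//; lra.
Qed.

Lemma homotopic_comp (X X' Y Y' : topologicalType) (f g : X -> Y)
    (u : X' -> X) (v : Y -> Y') : continuous u -> continuous v ->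
  homotopic R f g -> homotopic R (v \o f \o u) (v \o g \o u).
Proof.
move=> cu cv /homotopicP[H [cH H0 H1]]; apply/homotopicP.
exists (fun p => v (H (u p.1, p.2))); split; last 2 first.
- by move=> x /=; rewrite H0.
- by move=> x /=; rewrite H1.
apply: (continuous_compose _ cv); apply: (continuous_compose _ cH).
apply: continuous_pair; last exact: continuous_snd.
by apply: (continuous_compose _ cu); exact: continuous_fst.
Qed.

Lemma homotopy_equivalent_trans (X Y Z : topologicalType) :
  homotopy_equivalent R X Y -> homotopy_equivalent R Y Z ->
  homotopy_equivalent R X Z.
Proof.
move=> [f [f' [cf cf' f'f ff']]] [g [g' [cg cg' g'g gg']]].
exists (g \o f), (f' \o g'); split; try exact: continuous_compose.
  exact: homotopic_trans (homotopic_comp cf cf' g'g) f'f.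
exact: homotopic_trans (homotopic_comp cg' cg ff') gg'.
Qed.

Definition contractible (X : topologicalType) :=
  exists x : X, homotopic R idfun (fun _ : X => x).

Lemma contractible_equivalent (X Y : topologicalType) :
  homotopy_equivalent R X Y -> contractible Y -> contractible X.
Proof.
move=> [f [g [cf cg gf _]]] [y yP]; exists (g y).
exact: homotopic_trans (homotopic_sym gf) (homotopic_comp cf cg yP).
Qed.

Lemma contractible_point (X Y : topologicalType) (y : Y) :
  contractible X -> (forall z, z = y) -> homotopy_equivalent R X Y.
Proof.
move=> [x xP] yP; exists (fun _ => y), (fun _ => x).
split; try by move=> z; exact: cst_continuous.
  exact: homotopic_sym.
have -> : (fun _ => y) \o (fun _ => x) = @idfun Y.
  by apply/funext => z; rewrite /= [RHS]yP.
by apply: homotopic_refl => z; exact: cvg_id.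
Qed.

(** A continuous surjection [q] from a compact space onto a Hausdorff space stays
a quotient map after taking the product with any [T]. Indeed, by compactness, the
points of [X] that [q] does not send near [w] can be discarded all at once. *)
Lemma descend (X W T Y : topologicalType) (q : X -> W) (F : X * T -> Y) :
  compact [set: X] -> hausdorff_space W -> continuous q ->
  (forall w, exists x, q x = w) -> continuous F ->
  (forall x y t, q x = q y -> F (x, t) = F (y, t)) ->
  exists k : W * T -> Y, continuous k /\ forall x t, k (q x, t) = F (x, t).
Proof.
move=> cX hW cq /choice[s sP] cF Fq.
exists (fun p => F (s p.1, p.2)); split; last by move=> x t; exact/Fq/sP.
move=> [w t] U /= FU.
pose P (p : W * T) x := q x = p.1 -> U (F (x, p.2)).
suff : \forall p \near (w, t), [set: X] `<=` P p.
  by apply: filterS => -[w' t'] /= XP; exact/XP/sP.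
have /compact_near_coveringP nX := cX.
apply: (nX _ (nbhs (w, t)) P) => x _.
have [qx|qx] := pselect (q x = w).
  have cFx : \forall y \near (x, t), U (F y).
    by apply: cF; rewrite (Fq _ (s w)) ?sP.
  case: cFx => -[A B] /= [nA nB] AB.
  exists (A, [set p | B p.2]) => /=.
    by split=> //; exact: (@continuous_snd W T (w, t) B nB).
  by move=> [y p] /= [Ay Bp] _; exact: (AB (y, p.2)).
have : exists AB : set W * set W,
    [/\ nbhs (q x) AB.1, nbhs w AB.2 & AB.1 `&` AB.2 = set0].
  have := hW; rewrite open_hausdorff => /(_ _ _ (introN eqP qx)).
  move=> [[A B]] /= [+ +] [oA oB /eqP AB]; rewrite !inE => Aq Bw.
  by exists (A, B); split=> //; exact: open_nbhs_nbhs.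
move=> [[A B]] /= [nA nB AB].
exists (q @^-1` A, [set p | B p.1]) => /=.
  by split; [exact: (cq x A nA)|exact: (@continuous_fst W T (w, t) B nB)].
move=> [y p] /= [Ay Bp] qy; have : (A `&` B) (q y) by split; rewrite // qy.
by rewrite AB.
Qed.

(** The homotopy [h] collapses in [X] what [q] identifies, so its final stage
factors through [W] and gives a homotopy inverse of [q]; [h] itself descends to
the homotopy needed on [W]. *)
Lemma quotient_equivalence (X W : topologicalType) (q : X -> W)
    (h : X * R -> X) :
  compact [set: X] -> hausdorff_space W -> continuous q ->
  (forall w, exists x, q x = w) -> continuous h -> (forall x, h (x, 0) = x) ->
  (forall x y t, q x = q y -> q (h (x, t)) = q (h (y, t))) ->
  (forall x y, q x = q y -> h (x, 1) = h (y, 1)) ->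
  homotopy_equivalent R X W.
Proof.
move=> cX hW cq sq ch h0 hq h1.
have c1 : continuous (fun p : X * R => h (p.1, 1)).
  apply: continuous_compose ch; apply: continuous_pair.
    exact: continuous_fst.
  by move=> z; exact: cst_continuous.
have [|g [cg gq]] := descend cX hW cq sq c1.
  by move=> x y t /h1.
have [|k [ck kq]] := descend cX hW cq sq (continuous_compose ch cq).
  by move=> x y t /hq.
exists q, (fun w => g (w, 0)); split=> //.
- apply: (continuous_compose _ cg); apply: continuous_pair => z //.
  exact: cst_continuous.
- apply: homotopic_sym; apply/homotopicP; exists h; split=> // x.
  by rewrite /= gq.
- apply: homotopic_sym; apply/homotopicP; exists k; split=> // w.
    by have [x <-] := sq w; rewrite kq h0.
  by have [x <-] := sq w; rewrite kq /= gq.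
Qed.

End Real.

(** * Geometric realizations and elementary collapses *)

Section Realization.
Variables (R : realType) (V : finType).
Implicit Types (K L : {set {set V}}) (x : {ptws V -> R}) (s : {set V}).

Definition carrier x : {set V} := [set v | x v != 0]%SET.

Definition geom K : set {ptws V -> R} :=
  [set x | [/\ forall v, 0 <= x v, \sum_(v : V) x v = 1 & carrier x \in K]].

Definition polyhedron K : topologicalType := set_type (geom K).

Lemma polyhedronP K (x : polyhedron K) : geom K (\val x).
Proof. exact: set_valP. Qed.

Lemma continuous_coord v : continuous (fun x : {ptws V -> R} => x v).
Proof. exact: (@proj_continuous V (fun=> R) v). Qed.

Lemma continuous_polyhedron K v :
  continuous (fun x : polyhedron K => (\val x : {ptws V -> R}) v).
Proof.
exact: (continuous_compose (@continuous_val _ _) (@continuous_coord v)).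
Qed.

Lemma geom_le1 K x v : geom K x -> x v <= 1.
Proof. by move=> [x0 <- _]; rewrite (bigD1 v)//= lerDl sumr_ge0. Qed.

(** The initial value [1] does not matter for nonempty [s], since barycentric
coordinates are at most [1]. *)
Definition least s x : R := \big[Num.min/1]_(u in s) x u.

Lemma least_le s x u : u \in s -> least s x <= x u.
Proof. by move=> us; rewrite /least (bigD1 u)//= ge_min lexx. Qed.

Lemma le_least s x c : c <= 1 -> (forall u, u \in s -> c <= x u) -> c <= least s x.
Proof.
by move=> c1 cx; rewrite /least; elim/big_ind: _ => // a b ca cb; rewrite le_min ca.
Qed.

Lemma least_ge0 s x : (forall v, 0 <= x v) -> 0 <= least s x.
Proof. by move=> x0; apply: le_least. Qed.

Lemma least_attained s x : s != finset.set0 -> (forall v, x v <= 1) ->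
  exists2 u, u \in s & x u = least s x.
Proof.
move=> /finset.set0Pn[u0 u0s] x1.
have [u us umin] := @arg_minP _ R V u0 (mem s) x u0s.
exists u => //; apply/eqP; rewrite eq_le least_le// andbT.
exact: le_least.
Qed.

Lemma least_gt0 s x : (forall v, 0 <= x v) -> 0 < least s x -> s \subset carrier x.
Proof.
move=> x0 sx; apply/fintype.subsetP => u us; rewrite inE gt_eqF//.
exact: lt_le_trans (least_le _ us).
Qed.

Lemma continuous_least (Z : topologicalType) s (f : Z -> {ptws V -> R}) :
  (forall v, continuous (fun z => f z v)) -> continuous (fun z => least s (f z)).
Proof.
by move=> cf; apply: continuous_bigmin => // z; exact: cst_continuous.
Qed.

Section Collapse.
Variables (K : {set {set V}}) (s : {set V}) (w : V).
Hypotheses (ws : w \notin s) (s0 : s != finset.set0).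
Hypotheses (sK : s \notin K) (wsK : w |: s \notin K) (clK : face_closed K).
Let K1 := (w |: s) |: (s |: K).
Hypothesis clK1 : face_closed K1.

Let direction v : R := if v == w then #|s|%:R else if v \in s then -1 else 0.

Let sum_direction : \sum_v direction v = 0.
Proof.
rewrite (bigD1 w)//= {1}/direction eqxx (bigID (mem s))/=.
rewrite [X in _ + (X + _)](eq_bigr (fun=> -1)); last first.
  by move=> v /andP[/negbTE vw vs]; rewrite /direction vw vs.
rewrite [X in _ + (_ + X)]big1; last first.
  by move=> v /andP[/negbTE vw /negbTE vs]; rewrite /direction vw vs.
rewrite addr0 (eq_bigl (mem s)); last first.
  by move=> v; rewrite andb_idl// => vs; apply: contraNneq ws => <-.
by rewrite sumr_const mulNrn subrr.
Qed.

(** Where [least s x] is nonzero, the carrier of [x] contains [s], hence lies in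
[w |: s], and the motion stays in that simplex; elsewhere [x] does not move. *)
Let push x (t : R) : {ptws V -> R} := fun v => x v + t * least s x * direction v.

Let push_geom x t : geom K1 x -> 0 <= t <= 1 -> geom K1 (push x t).
Proof.
move=> Kx /andP[t0 t1]; have [x0 x1 xK] := Kx; have l0 := least_ge0 s x0.
have tl : 0 <= t * least s x by rewrite mulr_ge0.
have push_ge0 v : 0 <= push x t v.
  rewrite /push /direction; case: eqP => [_|_].
    by rewrite addr_ge0// mulr_ge0.
  case: ifP => [vs|_]; last by rewrite mulr0 addr0.
  rewrite mulrN1 subr_ge0 (le_trans _ (least_le _ vs))//.
  by rewrite ler_piMl.
split=> //; first by rewrite big_split/= -mulr_sumr sum_direction mulr0 addr0.
have [l_eq0|l_neq0] := eqVneq (least s x) 0.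
  rewrite (_ : carrier _ = carrier x)//; apply/finset.setP => v.
  by rewrite !inE /push l_eq0 mulr0 mul0r addr0.
have l_gt0 : 0 < least s x by rewrite lt_neqAle eq_sym l_neq0.
have s_x := least_gt0 x0 l_gt0.
have x_ws : carrier x \subset w |: s.
  move: xK; rewrite !inE => /or3P[/eqP->//|/eqP->|/(clK s_x)].
    exact: finset.subsetUr.
  by rewrite (negbTE sK).
apply: (clK1 (t := w |: s)); last by rewrite !inE eqxx.
apply/fintype.subsetP => v; rewrite inE; apply: contraR => vws.
have := contra (fintype.subsetP x_ws v) vws; rewrite inE negbK => /eqP xv.
move: vws; rewrite !inE negb_or => /andP[/negbTE vw /negbTE vs].
by rewrite /push xv /direction vw vs mulr0 addr0.
Qed.

Let push1_geom x : geom K1 x -> geom K (push x 1).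
Proof.
move=> Kx; have [p0 p1 pK] := @push_geom x 1 Kx (introT andP (conj ler01 (lexx 1))).
split=> //.
have [u us ul] := least_attained s0 (fun v => geom_le1 v Kx).
have uP : u \notin carrier (push x 1).
  rewrite inE negbK /push /direction us.
  have /negbTE-> : u != w by apply: contraNneq ws => <-.
  by rewrite ul mul1r mulrN1 subrr.
move: pK; rewrite /K1 !finset.in_setU !finset.in_set1 => /or3P[/eqP E|/eqP E|//].
  by rewrite E finset.setU1r in uP.
by rewrite E us in uP.
Qed.

Let push_fixed x t : geom K x -> push x t = x.
Proof.
move=> [x0 _ xK]; have [l_eq0|l_neq0] := eqVneq (least s x) 0.
  by apply/funext => v; rewrite /push l_eq0 mulr0 mul0r addr0.
have l_gt0 : 0 < least s x by rewrite lt_neqAle eq_sym l_neq0 least_ge0.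
by move: sK; rewrite (clK (least_gt0 x0 l_gt0) xK).
Qed.

Let geom_sub x : geom K x -> geom K1 x.
Proof. by move=> [x0 x1 xK]; split=> //; rewrite !inE xK !orbT. Qed.

(** Weight is transported linearly from the vertices of the free face [s] to [w],
until one of the coordinates over [s] vanishes. *)
Lemma collapse_equivalence : homotopy_equivalent R (polyhedron K1) (polyhedron K).
Proof.
have cpush (Z : topologicalType) (f : Z -> polyhedron K1) (t : Z -> R) v :
    continuous f -> continuous t -> continuous (fun z => push (\val (f z)) (t z) v).
  move=> cf ct; have cv u := continuous_compose cf (@continuous_polyhedron K1 u).
  apply: continuous_add; first exact: cv.
  apply: continuous_mul; last by move=> z; exact: cst_continuous.
  by apply: continuous_mul => //; exact: continuous_least.
pose f (x : polyhedron K1) : polyhedron K :=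
  to_set_type (push1_geom (polyhedronP x)).
pose g (x : polyhedron K) : polyhedron K1 :=
  to_set_type (geom_sub (polyhedronP x)).
have cf : continuous f.
  apply: continuous_set_type; apply: continuous_ptws => v.
  by apply: (cpush _ idfun (fun=> 1)) => z; [exact: cvg_id|exact: cst_continuous].
have cg : continuous g.
  by apply: continuous_set_type; exact: continuous_val.
exists f, g; split=> //.
  apply: homotopic_sym; apply/homotopicP.
  exists (fun p => to_set_type (push_geom (polyhedronP p.1) (clamp_itv p.2))).
  split=> [|x|x].
  - apply: continuous_set_type; apply: continuous_ptws => v.
    apply: (cpush _ fst (fun p => clamp p.2)); first exact: continuous_fst.
    by apply: continuous_clamp; exact: continuous_snd.
  - apply: val_inj => /=; rewrite clamp_id ?lexx ?ler01//.
    by apply/funext => v; rewrite /push !mul0r addr0.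
  - by apply: val_inj => /=; rewrite clamp_id ?lexx ?ler01.
have -> : f \o g = idfun.
  by apply/funext => x; apply: val_inj => /=; rewrite push_fixed//; exact: polyhedronP.
by apply: homotopic_refl => x; exact: cvg_id.
Qed.

End Collapse.

Lemma homotopy_equivalent_refl (X : topologicalType) : homotopy_equivalent R X X.
Proof.
by exists idfun, idfun; split; try (by move=> x; exact: cvg_id);
  apply: homotopic_refl => x; exact: cvg_id.
Qed.

Lemma collapses_closed L K : face_closed L -> collapses L K -> face_closed K.
Proof. by move=> clL; case. Qed.

Lemma collapses_equivalence L K : face_closed L -> finset.set0 \in L ->
  collapses L K -> homotopy_equivalent R (polyhedron K) (polyhedron L).
Proof.
move=> clL L0 colK; elim: colK => [|K' s w colK' IH ws sK' wsK' clK].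
  exact: homotopy_equivalent_refl.
apply: homotopy_equivalent_trans IH; apply: collapse_equivalence => //.
  apply: contraNneq sK' => ->.
  exact: (fintype.subsetP (collapses_sub colK') _ L0).
exact: collapses_closed colK'.
Qed.

(** The last pair removed consists of the empty simplex and a vertex, so the collapse
passes through a single point. *)
Lemma collapses_contractible K : K != finset.set0 ->
  collapses finset.set0 K -> contractible R (polyhedron K).
Proof.
move=> K0 colK; elim: colK K0 => [|K' s w colK' IH ws sK' wsK' clK K0].
  by rewrite eqxx.
have clK' : face_closed K' by apply: collapses_closed colK'; exact: face_closed0.
have [K'0|K'0] := eqVneq K' finset.set0; last first.
  apply: contractible_equivalent (IH K'0); apply: collapse_equivalence => //.
  apply: contraNneq sK' => ->; have [t tK'] := finset.set0Pn _ K'0.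
  by apply: clK' tK'; exact: finset.sub0set.
have s0 : s = finset.set0.
  have : finset.set0 \in (w |: s) |: (s |: K').
    by apply: (clK _ s); [exact: finset.sub0set|rewrite !inE eqxx orbT].
  rewrite K'0 !inE orbF => /orP[] /eqP // E.
  by have := finset.setU11 w s; rewrite -E inE.
have only x : geom ((w |: s) |: (s |: K')) x -> forall v, x v = (v == w)%:R.
  move=> [x0 x1]; rewrite K'0 s0 finset.setU0 !inE orbF => xK.
  have xv v : v != w -> x v = 0.
    move=> vw; apply/eqP; have : v \notin carrier x.
      by case/orP: xK => /eqP ->; rewrite !inE.
    by rewrite inE negbK.
  move=> v; case: eqVneq => [->|/xv//].
  by rewrite -x1 (bigD1 w)//= big1 ?addr0.
have ex : geom ((w |: s) |: (s |: K')) (fun v => (v == w)%:R).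
  split=> [v||]; first exact: ler0n.
    by rewrite (bigD1 w)//= eqxx big1 ?addr0// => v /negbTE->.
  rewrite s0 finset.setU0 !inE; apply/orP; left; apply/eqP/finset.setP => v.
  by rewrite !inE pnatr_eq0 eqb0 negbK.
exists (to_set_type ex); rewrite (_ : idfun = fun=> to_set_type ex).
  by apply: homotopic_refl => x; exact: cst_continuous.
apply/funext => x; apply: val_inj; apply/funext => v /=.
exact: (only _ (polyhedronP x)).
Qed.

End Realization.

(** * Collapsing a contractible subcomplex to a point *)

Lemma compact_set_type (X : topologicalType) (A : set X) :
  compact A -> compact [set: set_type A].
Proof.
move=> cA F PF _; pose G : set_system X := [set U | F (@set_val X A @^-1` U)].
have PG : ProperFilter G by exact: fmap_proper_filter.
have GA : G A.
  by apply: (@filterS _ F _ setT) => [x _|]; [exact: set_valP|exact: filterT].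
have [x [Ax xG]] := cA G PG GA; exists (to_set_type Ax); split=> // U N FU xN.
have [W [oW Wx WN]] : exists W : set X,
    [/\ open W, W x & @set_val X A @^-1` W `<=` N].
  by case: xN => /= _ [[W oW <-] Wx WN]; exists W.
have GU : G (@set_val X A @` U).
  by apply: (@filterS _ F _ U) => // y Uy; exists y.
have [_ [[y Uy <-] Wy]] := xG _ _ GU (open_nbhs_nbhs (conj oW Wx)).
by exists y; split=> //; exact: WN.
Qed.

Lemma hausdorff_set_type (X : topologicalType) (A : set X) :
  hausdorff_space X -> hausdorff_space (set_type A).
Proof.
move=> hX x y xy; apply: val_inj; apply: hX => U N xU yN.
have [z [/= Uz Nz]] := xy _ _ (@continuous_val X A x U xU) (@continuous_val X A y N yN).
by exists (\val z).
Qed.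

Section Polyhedron.
Variables (R : realType) (V : finType).

Lemma compact_geom (K : {set {set V}}) : face_closed K -> compact (@geom R V K).
Proof.
move=> clK.
have cube : compact [set x : {ptws V -> R} | forall v, `[0, 1]%classic (x v)].
  exact: (@tychonoff V (fun=> R : topologicalType) (fun=> `[0, 1]%classic)
    (fun=> @segment_compact R 0 1)).
have cv v := @continuous_coord R V v.
pose B1 := [set x : {ptws V -> R} | \sum_(v : V) x v = 1].
(* As [K] is closed under faces, a carrier belongs to [K] when the coordinates over
   each nonface have a vanishing product. *)
pose B2 := \bigcap_(A in [set A : {set V} | A \notin K])
  [set x : {ptws V -> R} | \prod_(v in A) x v = 0].
have c1 : closed B1.
  apply: (@closed_comp _ _ (fun x : {ptws V -> R} => \sum_(v : V) x v) [set 1]).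
    have cs : continuous (fun x : {ptws V -> R} => \sum_(v : V) x v).
      by apply: continuous_sum => v; exact: cv.
    by move=> x _; exact: cs.
  exact: closed_eq.
have c2 : closed B2.
  apply: closed_bigI => A _.
  apply: (@closed_comp _ _ (fun x : {ptws V -> R} => \prod_(v in A) x v) [set 0]).
    have cp : continuous (fun x : {ptws V -> R} => \prod_(v in A) x v).
      by apply: continuous_prod => v; exact: cv.
    by move=> x _; exact: cp.
  exact: closed_eq.
pose B0 := \bigcap_(v in [set: V]) [set x : {ptws V -> R} | 0 <= x v].
have c0 : closed B0.
  apply: closed_bigI => v _.
  apply: (@closed_comp _ _ (fun x : {ptws V -> R} => x v) [set t | 0 <= t]).
    by move=> x _; exact: cv.
  exact: closed_ge.
apply: (subclosed_compact _ cube) => [|x Kx v]; last first.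
  by rewrite /= in_itv/= (geom_le1 _ Kx) andbT; case: Kx.
rewrite (_ : geom K = B0 `&` (B1 `&` B2)).
  by apply: closedI => //; exact: closedI.
apply/seteqP; split=> x.
  move=> [x0 x1 xK]; split; first by move=> v _; exact: x0.
  split=> // A /= AK; apply/eqP; rewrite prodf_seq_eq0.
  apply: contraNT AK; rewrite -all_predC => /allP xA.
  apply: clK xK; apply/fintype.subsetP => v vA.
  by have := xA v (mem_index_enum v); rewrite /= vA inE.
move=> [x0 [x1 xK]]; split=> //; first by move=> v; exact: x0.
apply: contraPT (eqxx (0 : R)) => /xK /= x_eq0.
have /prodf_neq0 : forall v, v \in carrier x -> x v != 0 by move=> v; rewrite inE.
by rewrite x_eq0 eqxx.
Qed.

End Polyhedron.

Lemma continuous_mx (Z : topologicalType) (R : realType) (m n : nat)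
    (f : Z -> 'M[R]_(m, n)) :
  (forall i j, continuous (fun z => f z i j)) -> continuous f.
Proof.
move=> cf z A [P fP PA].
have : \forall z' \near z, forall i j, P i j (f z' i j).
  apply: filter_forall => i; apply: filter_forall => j.
  exact: (cf i j z (P i j) (fP i j)).
by apply: filterS => z' Pz'; exact: PA.
Qed.

Lemma stereographic_slope (R : realFieldType) (s h o : R) :
  0 < h -> 0 < s + h ^+ 2 ->
  o = h * ((2 * h * o / (s + h ^+ 2)) / (1 - (s - h ^+ 2) / (s + h ^+ 2))).
Proof.
move=> h0 D0; have [h_neq0 D_neq0] := (lt0r_neq0 h0, lt0r_neq0 D0).
have -> : 1 - (s - h ^+ 2) / (s + h ^+ 2) = 2 * h ^+ 2 / (s + h ^+ 2).
  by field.
by field; rewrite h_neq0 D_neq0.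
Qed.

Lemma first_coordinate (R : realFieldType) (D a h e : R) : D != 0 ->
  h = D * (a + h * e) -> a = h * (1 / D - e).
Proof.
move=> D0 hE; have -> : a = (D * (a + h * e)) / D - h * e by field.
by rewrite -hE; field.
Qed.
Lemma total_height (R : realFieldType) (D h e s : R) : D != 0 ->
  h * (1 + s - D * e) = h * (1 / D - e) * D + h * s.
Proof. by move=> D0; field. Qed.

Lemma projection_pole (R : realFieldType) (h u0 n : R) : h != 0 -> 1 - u0 != 0 ->
  n * (1 - u0) = 1 + u0 ->
  (h ^+ 2 * n - h ^+ 2) / (h ^+ 2 * n + h ^+ 2) = u0.
Proof.
move=> h0 u1 nE; have -> : n = (1 + u0) / (1 - u0) by rewrite -nE mulfK.
field; rewrite u1 /=.
have -> : h ^+ 2 * (1 + u0) + h ^+ 2 * (1 - u0) = 2 * h ^+ 2 by ring.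
by rewrite mulf_neq0 ?expf_neq0 ?pnatr_eq0.
Qed.

Lemma projection_equator (R : realFieldType) (h u0 u n : R) :
  h != 0 -> 1 - u0 != 0 -> n * (1 - u0) = 1 + u0 ->
  (2 * h * (h * (u / (1 - u0)))) / (h ^+ 2 * n + h ^+ 2) = u.
Proof.
move=> h0 u1 nE; have -> : n = (1 + u0) / (1 - u0) by rewrite -nE mulfK.
field; rewrite u1 /=.
have -> : h ^+ 2 * (1 + u0) + h ^+ 2 * (1 - u0) = 2 * h ^+ 2 by ring.
by rewrite mulf_neq0 ?expf_neq0 ?pnatr_eq0.
Qed.

Section Facets.
Variables (R : realType) (V : finType) (d m : nat) (L : {set {set V}}).
Variable p : 'I_m.+1 -> 'I_d.+1 -> V.
Hypothesis p_inj : forall i, injective (p i).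
Let F i : {set V} := [set p i j | j : 'I_d.+1]%SET.
Let K := L :|: [set F i | i : 'I_m.+1]%SET.
Hypotheses (F_inj : injective F) (FL : forall i, F i \notin L).
Hypotheses (clL : face_closed L) (clK : face_closed K).
Implicit Types (x : {ptws V -> R}) (i : 'I_m.+1).

Let card_F i : #|F i| = d.+1.
Proof. by rewrite finset.card_imset ?card_ord//; exact: p_inj. Qed.

Let p_F i j : p i j \in F i.
Proof. exact: finset.imset_f. Qed.

Let F_neq0 i : F i != finset.set0.
Proof. by rewrite -finset.card_gt0 card_F. Qed.

Let F_K i : F i \in K.
Proof. by rewrite finset.in_setU finset.imset_f ?orbT. Qed.

Let L_K : L \subset K.
Proof. exact: finset.subsetUl. Qed.

Let sub_F i (s : {set V}) : s \subset F i -> s \in K -> s \in L \/ s = F i.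
Proof.
move=> sF /finset.setUP[|/finset.imsetP[j _ sj]]; first by left.
by right; apply/eqP; rewrite finset.eqEcard sF sj !card_F leqnn.
Qed.

Let geom_LK x : geom L x -> geom K x.
Proof. by case=> x0 x1 xL; split=> //; exact: (fintype.subsetP L_K). Qed.

(** Normalized so as to be [1] at the barycenter of the facet. *)
Let height i x : R := d.+1%:R * least (F i) x.

Let height_le i x v : v \in F i -> height i x <= d.+1%:R * x v.
Proof. by move=> vF; rewrite ler_pM2l ?ltr0Sn// least_le. Qed.

Let height_ge0 i x : (forall v, 0 <= x v) -> 0 <= height i x.
Proof. by move=> x0; rewrite mulr_ge0 ?ler0n// least_ge0. Qed.

Let height_attained i x : geom K x ->
  exists2 v, v \in F i & height i x = d.+1%:R * x v.
Proof.
move=> Kx; have [v vF vx] := least_attained (F_neq0 i) (fun v => geom_le1 v Kx).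
by exists v; rewrite // /height vx.
Qed.

Let height_carrier i x : geom K x -> 0 < height i x -> carrier x = F i.
Proof.
move=> [x0 _ xK]; rewrite pmulr_rgt0 ?ltr0Sn// => /(least_gt0 x0) Fx.
have /finset.setUP[xL|/finset.imsetP[j _ xj]] := xK.
  by have := FL i; rewrite (clL Fx xL).
by apply/eqP; rewrite eq_sym finset.eqEcard Fx xj !card_F leqnn.
Qed.

Let height_neq i j x : geom K x -> 0 < height i x -> j != i -> height j x = 0.
Proof.
move=> Kx hi ji; apply/eqP; rewrite eq_le height_ge0 ?andbT; last by case: Kx.
rewrite leNgt; apply: contra ji => hj; apply/eqP/F_inj.
by rewrite -(height_carrier Kx hi) -(height_carrier Kx hj).
Qed.

Let height_L i x : geom L x -> height i x = 0.
Proof.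
move=> Lx; have Kx := geom_LK Lx; have [x0 _ xL] := Lx.
apply/eqP; rewrite eq_le height_ge0 ?andbT// leNgt; apply/negP => hi.
by have := FL i; rewrite -(height_carrier Kx hi) xL.
Qed.

Let geom_cases x : geom K x ->
  geom L x \/ exists2 i, 0 < height i x & forall j, j != i -> height j x = 0.
Proof.
move=> Kx; have [x0 x1 xK] := Kx.
have [i hi|h0] := pickP (fun i => 0 < height i x).
  by right; exists i => // j ji; exact: height_neq hi ji.
left; split=> //; have /finset.setUP[//|/finset.imsetP[i _ xi]] := xK.
have [v vF vx] := height_attained i Kx.
have := h0 i; rewrite vx pmulr_rgt0 ?ltr0Sn// lt_neqAle x0 andbT eq_sym.
by move: vF; rewrite -xi inE => ->.
Qed.

Let center i v : R := (v \in F i)%:R / d.+1%:R.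

Let sum_center i : \sum_v center i v = 1.
Proof.
rewrite -mulr_suml -natr_sum -big_mkcond/= sum1_card card_F divff//.
by rewrite pnatr_eq0.
Qed.

Let cut i x (t : R) : R := Num.min (height i x) (t / 2).

(** Radial expansion away from the barycenters: what lies at height at most [t / 2] is
pushed to the boundary of its facet. At most one summand is nonzero at a point of the
polyhedron, and there the denominator is at least [1 / 2] as long as [t] is at most
[1]. *)
Let expand x t : {ptws V -> R} :=
  fun v => (x v - \sum_i cut i x t * center i v) / (1 - \sum_i cut i x t).

Let cut0 i x t : 0 <= t -> height i x = 0 -> cut i x t = 0.
Proof. by move=> t0 h0; rewrite /cut h0 min_l// divr_ge0. Qed.

Let expand_L x t : 0 <= t -> geom L x -> expand x t = x.
Proof.
move=> t0 Lx; apply/funext => v; rewrite /expand !big1 ?subr0 ?divr1// => i _.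
  by rewrite cut0// ?height_L.
by rewrite cut0// ?height_L// mul0r.
Qed.

Let expand0 x : geom K x -> expand x 0 = x.
Proof.
move=> [x0 _ _]; have c0 i : cut i x 0 = 0.
  by rewrite /cut mul0r min_r// height_ge0.
apply/funext => v; rewrite /expand !big1 ?subr0 ?divr1// => i _.
by rewrite c0 mul0r.
Qed.

Let expand_facet i x t : 0 <= t -> (forall j, j != i -> height j x = 0) ->
  expand x t = fun v => (x v - cut i x t * center i v) / (1 - cut i x t).
Proof.
move=> t0 hj; apply/funext => v; rewrite /expand (bigD1 i)//= big1 ?addr0.
  by rewrite (bigD1 i)//= big1 ?addr0// => j /hj; exact: cut0.
by move=> j /hj h0; rewrite cut0// mul0r.
Qed.

Let expand_geom x t : geom K x -> 0 <= t <= 1 -> geom K (expand x t).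
Proof.
move=> Kx /andP[t0 t1]; have [Lx|[i hi hj]] := geom_cases Kx.
  by rewrite expand_L.
have [x0 x1 _] := Kx; have xF := height_carrier Kx hi.
have xv v : v \notin F i -> x v = 0.
  by rewrite -xF inE negbK => /eqP.
rewrite (expand_facet t0 hj); set c := cut i x t.
have [c_h c_t] : c <= height i x /\ c <= t / 2.
  by split; rewrite ge_min lexx ?orbT.
have c1 : 0 < 1 - c by lra.
split=> [v||].
- rewrite divr_ge0// ?(ltW c1)// subr_ge0 /center.
  have [vF|vF] := boolP (v \in F i); last by rewrite xv// mul0r mulr0.
  rewrite mulrA mulr1 ler_pdivrMr ?ltr0Sn// mulrC.
  by rewrite [leRHS]mulrC mulrC; apply: le_trans (height_le _ vF).
- by rewrite -mulr_suml sumrB x1 -mulr_sumr sum_center mulr1 divff// gt_eqF.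
apply: clK (F_K i); apply/fintype.subsetP => v; rewrite inE; apply: contraR => vF.
by rewrite xv// /center (negbTE vF) mul0r mulr0 subrr mul0r.
Qed.

Let expand_low x t : geom K x -> 0 <= t <= 1 -> \sum_i height i x - t / 2 <= 0 ->
  geom L (expand x t).
Proof.
move=> Kx t01 ht; have [e0 e1 eK] := expand_geom Kx t01.
have [t0 t1] := andP t01; have [Lx|[i hi hj]] := geom_cases Kx.
  by rewrite expand_L.
split=> //; have eE := expand_facet t0 hj.
have hit : height i x <= t / 2.
  by move: ht; rewrite (bigD1 i)//= big1 ?addr0 ?subr_le0// => j /hj.
have cE : cut i x t = height i x by rewrite /cut min_l.
have [x0 x1 _] := Kx; have xF := height_carrier Kx hi.
have eF : carrier (expand x t) \subset F i.
  apply/fintype.subsetP => v; rewrite inE; apply: contraR => vF.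
  have /eqP xv : x v == 0 by move: vF; rewrite -xF inE negbK.
  by rewrite eE xv /center (negbTE vF) mul0r mulr0 subrr mul0r.
have [//|E] := sub_F eF eK.
have [v vF vx] := height_attained i Kx.
have : v \in carrier (expand x t) by rewrite E.
rewrite inE eE cE vx /center vF mul1r.
by rewrite mulrAC divff ?pnatr_eq0// mul1r subrr mul0r eqxx.
Qed.

Let continuous_height (Z : topologicalType) (f : Z -> polyhedron R K) i :
  continuous f -> continuous (fun z => height i (\val (f z))).
Proof.
move=> cf; apply: continuous_mul; first by move=> z; exact: cst_continuous.
apply: continuous_least => v.
exact: (continuous_compose cf (@continuous_polyhedron R V K v)).
Qed.

Let continuous_expand (Z : topologicalType) (f : Z -> polyhedron R K) (t : Z -> R) :
  continuous f -> continuous t -> (forall z, 0 <= t z <= 1) ->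
  continuous (fun z => expand (\val (f z)) (t z)).
Proof.
move=> cf ct t01; have cc i : continuous (fun z => cut i (\val (f z)) (t z)).
  apply: continuous_minf; first exact: continuous_height.
  by apply: continuous_mul => // z; exact: cst_continuous.
apply: continuous_ptws => v; apply: continuous_mul.
  apply: continuous_sub.
    exact: (continuous_compose cf (@continuous_polyhedron R V K v)).
  apply: continuous_sum => i; apply: continuous_mul => // z.
  exact: cst_continuous.
apply: continuous_inv.
  apply: continuous_sub; first by move=> z; exact: cst_continuous.
  exact: continuous_sum.
move=> z; have Kx := polyhedronP (f z); have /andP[t0 t1] := t01 z.
have [Lx|[i hi hj]] := geom_cases Kx.
  by rewrite big1 ?subr0 ?oner_neq0// => i _; rewrite cut0// height_L.
rewrite (bigD1 i)//= big1 ?addr0; last by move=> j /hj; exact: cut0.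
have : cut i (\val (f z)) (t z) <= t z / 2 by rewrite ge_min lexx orbT.
by move=> ?; rewrite gt_eqF//; lra.
Qed.

Hypothesis contrL : contractible R (polyhedron R L).

Let in_L (x : polyhedron R K) := geom L (\val x).

(** The homotopy extension property of [L] in the polyhedron. A point is first moved by
the expansion; once it reaches [L], it follows the contraction [C] of [L] for the
remaining time. *)
Let contraction_extends : exists h : polyhedron R K * R -> polyhedron R K,
  [/\ continuous h, forall x : polyhedron R K, h (x, 0) = x,
      forall (x : polyhedron R K) t, in_L x -> in_L (h (x, t)) &
      forall x y : polyhedron R K, in_L x -> in_L y -> h (x, 1) = h (y, 1)].
Proof.
have [a /homotopicP[C [cC C0 C1]]] := contrL.
pose phi (q : polyhedron R K * R) : R :=
  \sum_i height i (\val q.1) - clamp q.2 / 2.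
have ct : continuous (fun q : polyhedron R K * R => clamp q.2).
  by apply: continuous_clamp; exact: continuous_snd.
have cphi : continuous phi.
  apply: continuous_sub.
    by apply: continuous_sum => i; apply: continuous_height; exact: continuous_fst.
  by apply: continuous_mul => // z; exact: cst_continuous.
pose e (q : polyhedron R K * R) : {ptws V -> R} := expand (\val q.1) (clamp q.2).
have ce : continuous e.
  by apply: continuous_expand => // [|z]; [exact: continuous_fst|exact: clamp_itv].
have eK q : geom K (e q) := expand_geom (polyhedronP q.1) (clamp_itv q.2).
have eL (q : set_type [set q | phi q <= 0]) : geom L (e (\val q)).
  exact: (expand_low (polyhedronP _) (clamp_itv _) (set_valP q)).
pose incl (y : polyhedron R L) : polyhedron R K :=
  to_set_type (geom_LK (polyhedronP y)).
have cincl : continuous incl by apply: continuous_set_type; exact: continuous_val.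
have [||q r qr|h [ch hlow hhigh]] := paste
  (f := fun q : set_type [set q | phi q <= 0] =>
    incl (C (to_set_type (eL q), - 2 * phi (\val q))))
  (g := fun q : set_type [set q | 0 <= phi q] => to_set_type (eK (\val q))) cphi.
- apply: (continuous_compose _ cincl); apply: (continuous_compose _ cC).
  apply: continuous_pair.
    by apply: continuous_set_type; exact: (continuous_compose (@continuous_val _ _) ce).
  apply: continuous_mul; first by move=> z; exact: cst_continuous.
  exact: (continuous_compose (@continuous_val _ _) cphi).
- by apply: continuous_set_type; exact: (continuous_compose (@continuous_val _ _) ce).
- have q0 := set_valP q; have r0 := set_valP r.
  have -> : phi (\val q) = 0.
    by apply/eqP; rewrite eq_le [X in X && _]q0 qr [X in _ && X]r0.
  by rewrite mulr0 C0; apply: val_inj => /=; rewrite qr.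
have clamp0 : clamp (0 : R) = 0 by rewrite clamp_id ?lexx ?ler01.
have clamp1 : clamp (1 : R) = 1 by rewrite clamp_id ?lexx ?ler01.
have phi_L (x : polyhedron R K) t : in_L x -> phi (x, t) = - (clamp t / 2).
  by move=> Lx; rewrite /phi big1 ?sub0r// => i _; exact: height_L.
have low (x : polyhedron R K) t : in_L x -> [set q | phi q <= 0] (x, t).
  move=> Lx; rewrite /= phi_L// oppr_le0 divr_ge0//.
  by case/andP: (clamp_itv t).
have hL (x : polyhedron R K) t (Lx : in_L x) : 
    h (x, t) = incl (C (@to_set_type _ (geom L) _ Lx, clamp t)).
  rewrite (hlow (to_set_type (low x t Lx))) /= phi_L//; congr (incl (C (_, _))).
    apply: val_inj => /=; rewrite /e /= expand_L//.
    by case/andP: (clamp_itv t).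
  by rewrite mulrN mulNr opprK mulrC divfK// pnatr_eq0.
exists h; split=> // [x|x t Lx|x y Lx Ly].
- have x_high : [set q | 0 <= phi q] (x, 0).
    rewrite /= /phi clamp0 mul0r subr0 sumr_ge0// => i _.
    by apply: height_ge0; case: (polyhedronP x).
  rewrite (hhigh (to_set_type x_high)); apply: val_inj => /=.
  by rewrite /e /= clamp0 expand0//; exact: polyhedronP.
- by rewrite (hL _ _ Lx); exact: polyhedronP.
- by rewrite (hL _ _ Lx) (hL _ _ Ly) clamp1 !C1.
Qed.

(** In the coordinates [offset i x] of the facet [F i] the map below is inverse
stereographic projection of [offset i x / height i x]. Where the height is zero
its value is the pole; the term [(1 - \sum_j x (p i j)) ^+ 2], which vanishes on
[F i], keeps the denominator away from zero there. *)
Let offset i x j : R := x (p i j) - x (p i ord0).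

Let sqnorm i x : R :=
  \sum_j offset i x j ^+ 2 + (1 - \sum_j x (p i j)) ^+ 2.

Let bubble_row i x : 'rV[R]_d.+1 :=
  \row_j (((sqnorm i x - height i x ^+ 2) * (j == ord0)%:R
           + 2 * height i x * offset i x j) / (sqnorm i x + height i x ^+ 2)).

Let sqnorm_ge0 i x : 0 <= sqnorm i x.
Proof. by rewrite addr_ge0 ?sqr_ge0// sumr_ge0// => j _; exact: sqr_ge0. Qed.

Let denominator_gt0 i x : geom K x -> 0 < sqnorm i x + height i x ^+ 2.
Proof.
move=> Kx; rewrite lt_neqAle addr_ge0 ?sqnorm_ge0 ?sqr_ge0// andbT eq_sym.
rewrite paddr_eq0 ?sqnorm_ge0 ?sqr_ge0// sqrf_eq0 paddr_eq0 ?sqr_ge0 ?sumr_ge0//; last first.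
  by move=> j _; exact: sqr_ge0.
apply/negP => /andP[/andP[off0 sum1] /eqP h0].
have [v /finset.imsetP[k _ ->] vx] := height_attained i Kx.
have xk : x (p i k) = 0.
  by move/eqP: vx; rewrite h0 eq_sym mulf_eq0 pnatr_eq0 => /eqP.
have same j : x (p i j) = x (p i ord0).
  apply/eqP; rewrite -subr_eq0 -sqrf_eq0.
  by move: off0; rewrite psumr_eq0 => [/allP/(_ j (mem_index_enum j))|l _];
    last exact: sqr_ge0.
move: sum1; rewrite big1 => [|j _]; last by rewrite same -(same k).
by rewrite subr0 expr1n oner_eq0.
Qed.

Let offset0 i x : offset i x ord0 = 0.
Proof. by rewrite /offset subrr. Qed.

Let sum_facet i x : geom K x -> 0 < height i x -> \sum_j x (p i j) = 1.
Proof.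
move=> Kx hi; have [_ x1 _] := Kx; have xF := height_carrier Kx hi.
rewrite -x1 (bigID (mem (F i)))/= [X in _ + X]big1 ?addr0; last first.
  by move=> v; rewrite -xF inE negbK => /eqP.
by rewrite big_imset//= => j k _ _; exact: p_inj.
Qed.

Let bubble_sphere i x : geom K x -> unit_sphere R d (bubble_row i x).
Proof.
move=> Kx; rewrite /unit_sphere /=; have D0 := denominator_gt0 i Kx.
set D := sqnorm i x + height i x ^+ 2 in D0 *.
have D_neq0 : D != 0 by rewrite gt_eqF.
have crossE : \sum_j (bubble_row i x) 0 j ^+ 2 =
    ((sqnorm i x - height i x ^+ 2) ^+ 2
     + 4 * height i x ^+ 2 * \sum_j offset i x j ^+ 2) / D ^+ 2.
  rewrite [X in (_ + X) / _]mulr_sumr (bigD1 ord0)//= [in RHS](bigD1 ord0)//=.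
  rewrite !mxE eqxx mulr1 offset0 !mulr0 addr0 expr0n/= mulr0 add0r.
  rewrite [in RHS]mulrDl expr_div_n; congr (_ + _).
  rewrite mulr_suml; apply: eq_bigr => j /negbTE j0.
  by rewrite mxE j0 mulr0 add0r expr_div_n; congr (_ / _); ring.
have D2_neq0 : D ^+ 2 != 0 by rewrite expf_neq0.
rewrite crossE -[RHS](divff D2_neq0); congr (_ / _).
have [h0|h0] := eqVneq (height i x) 0.
  by rewrite /D h0 expr0n/= mulr0 mul0r !addr0 subr0.
have hi : 0 < height i x.
  by rewrite lt_neqAle eq_sym h0 height_ge0//; case: Kx.
have -> : \sum_j offset i x j ^+ 2 = sqnorm i x.
  by rewrite /sqnorm sum_facet// subrr expr0n addr0.
by rewrite /D; ring.
Qed.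

Let bubble i (y : polyhedron R K) : sphere R d :=
  to_set_type (bubble_sphere i (polyhedronP y)).

Let bubble_pole i (y : polyhedron R K) :
  height i (\val y) = 0 -> bubble i y = sphere_base R d.
Proof.
move=> h0; apply: val_inj => /=; apply/rowP => j; rewrite !mxE h0.
have := denominator_gt0 i (polyhedronP y); rewrite h0 expr0n/= addr0 => D0.
rewrite subr0 mulr0 mul0r addr0 /=; case: eqP => _.
  by rewrite mulr1 divff// gt_eqF.
by rewrite mulr0 mul0r.
Qed.

Let bubble_pole_inv i (y : polyhedron R K) :
  bubble i y = sphere_base R d -> height i (\val y) = 0.
Proof.
move=> /(congr1 (fun u => (\val u : 'rV[R]_d.+1) 0 ord0)) /=.
have D0 := denominator_gt0 i (polyhedronP y).
rewrite !mxE !eqxx/= mulr1 offset0 mulr0 addr0.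
move=> /(congr1 ( *%R^~ (sqnorm i (\val y) + height i (\val y) ^+ 2))).
rewrite divfK ?gt_eqF// mul1r => E.
by apply/eqP; rewrite -sqrf_eq0; apply/eqP; lra.
Qed.

Let continuous_bubble i : continuous (bubble i).
Proof.
have cx v := @continuous_polyhedron R V K v.
have ch : continuous (fun y : polyhedron R K => height i (\val y)).
  by apply: (continuous_height (f := idfun)) => y; exact: cvg_id.
have ch2 : continuous (fun y : polyhedron R K => height i (\val y) ^+ 2).
  exact: continuous_mul.
have coff j : continuous (fun y : polyhedron R K => offset i (\val y) j).
  exact: continuous_sub.
have cs : continuous (fun y : polyhedron R K => sqnorm i (\val y)).
  apply: continuous_add; first by apply: continuous_sum => j; exact: continuous_mul.
  have c1 : continuous (fun y : polyhedron R K =>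
      1 - \sum_j (\val y : {ptws V -> R}) (p i j)).
    apply: continuous_sub; first by move=> z; exact: cst_continuous.
    by apply: continuous_sum => j; exact: cx.
  exact: continuous_mul.
apply: continuous_set_type; apply: continuous_mx => r j.
rewrite (_ : (fun y => _) = fun y : polyhedron R K =>
    ((sqnorm i (\val y) - height i (\val y) ^+ 2) * (j == ord0)%:R
     + 2 * height i (\val y) * offset i (\val y) j)
    / (sqnorm i (\val y) + height i (\val y) ^+ 2)); last first.
  by apply/funext => y; rewrite /= mxE.
apply: continuous_mul.
  apply: continuous_add.
    apply: continuous_mul; last by move=> z; exact: cst_continuous.
    exact: continuous_sub.
  apply: continuous_mul => //; apply: continuous_mul => //.
  by move=> z; exact: cst_continuous.
apply: continuous_inv; first exact: continuous_add.
by move=> y; rewrite gt_eqF//; apply: denominator_gt0; exact: polyhedronP.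
Qed.

(** The values of [bubble i] determine the slopes [offset / height], and these
determine the height since the coordinates over the facet add up to one. *)
Let bubble_inj i (y z : polyhedron R K) : 0 < height i (\val y) ->
  0 < height i (\val z) -> bubble i y = bubble i z -> y = z.
Proof.
move=> hy hz yz; have [Ky Kz] := (polyhedronP y, polyhedronP z).
have slope (u : polyhedron R K) j : 0 < height i (\val u) ->
    offset i (\val u) j = height i (\val u) *
      ((\val (bubble i u) : 'rV[R]_d.+1) 0 j
       / (1 - (\val (bubble i u) : 'rV[R]_d.+1) 0 ord0)
       * (j != ord0)%:R).
  move=> hu; have D0 := denominator_gt0 i (polyhedronP u).
  rewrite /= !mxE eqxx mulr1 offset0 mulr0 addr0.
  case: eqVneq => [->|j0]; first by rewrite offset0 !mulr0.
  rewrite mulr0 add0r mulr1; exact: stereographic_slope.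
pose e j : R := (\val (bubble i y) : 'rV[R]_d.+1) 0 j
  / (1 - (\val (bubble i y) : 'rV[R]_d.+1) 0 ord0) * (j != ord0)%:R.
have ey j := slope y j hy; have ez j := slope z j hz; rewrite -yz in ez.
(* The height is determined by the slopes [e]: the smallest coordinate over the
   facet has the smallest slope. *)
have heightE (u : polyhedron R K) : 0 < height i (\val u) ->
    (forall j, offset i (\val u) j = height i (\val u) * e j) ->
    exists2 k, forall j, e k <= e j &
      height i (\val u) * (1 + \sum_j e j - d.+1%:R * e k) = 1 /\
      (\val u : {ptws V -> R}) (p i ord0) = height i (\val u) * (1 / d.+1%:R - e k).
  move=> hu eu; have Ku := polyhedronP u.
  have xE j : (\val u : {ptws V -> R}) (p i j) =
      (\val u : {ptws V -> R}) (p i ord0) + height i (\val u) * e j.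
    by rewrite -eu /offset addrC subrK.
  have [v /finset.imsetP[k _ ->] vx] := height_attained i Ku; exists k.
    move=> j; have := height_le (\val u) (p_F i j).
    by rewrite vx ler_pM2l ?ltr0Sn// (xE k) (xE j) lerD2l ler_pM2l.
  have d0 : d.+1%:R != 0 :> R by rewrite pnatr_eq0.
  have x0 : (\val u : {ptws V -> R}) (p i ord0) =
      height i (\val u) * (1 / d.+1%:R - e k).
    by apply: first_coordinate d0 _; rewrite -xE.
  split=> //; have := sum_facet Ku hu.
  rewrite (eq_bigr _ (fun j _ => xE j)) big_split/= sumr_const card_ord -mulr_sumr x0.
  by rewrite (total_height _ _ _ d0) mulr_natr.
have [k ky [y1 y0]] := heightE y hy ey; have [k' kz [z1 z0]] := heightE z hz ez.
have kk' : e k = e k' by apply/eqP; rewrite eq_le ky kz.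
rewrite -kk' in z1 z0.
have hyz : height i (\val y) = height i (\val z).
  have c0 : 1 + \sum_j e j - d.+1%:R * e k != 0.
    by apply: contra_eq_neq y1 => ->; rewrite mulr0 eq_sym oner_neq0.
  by apply: (mulIf c0); rewrite y1 z1.
apply: val_inj; apply/funext => v.
have [|vF] := boolP (v \in F i).
  move=> /finset.imsetP[j _ ->].
  have := ey j; have := ez j; rewrite /offset -/(e j) y0 z0 hyz => zj yj.
  by apply: (addIr (- (height i (\val z) * (1 / d.+1%:R - e k)))); rewrite yj zj.
have [cy cz] := (height_carrier Ky hy, height_carrier Kz hz).
have /eqP-> : (\val y : {ptws V -> R}) v == 0 by move: vF; rewrite -cy inE negbK.
by apply/esym/eqP; move: vF; rewrite -cz inE negbK.
Qed.

(** The same computation backwards: [e] lists the slopes read off from [u], and the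
height [h] is forced by the sum of the coordinates. *)
Let bubble_onto i (u : sphere R d) : u <> sphere_base R d ->
  exists2 y : polyhedron R K, 0 < height i (\val y) & bubble i y = u.
Proof.
move=> u_pole; pose U : 'rV[R]_d.+1 := \val u.
have U1 : \sum_j U 0 j ^+ 2 = 1 := set_valP u.
have U0_1 : U 0 ord0 < 1.
  have U0_le : U 0 ord0 ^+ 2 <= 1.
    by rewrite -U1 (bigD1 ord0)//= lerDl sumr_ge0// => j _; exact: sqr_ge0.
  have U0_le1 : U 0 ord0 <= 1.
    rewrite leNgt; apply: contraTN U0_le => U0_gt1.
    by rewrite -ltNge exprn_egt1.
  rewrite lt_neqAle U0_le1 andbT.
  apply: contra_notN u_pole => /eqP U0; apply: val_inj; apply/rowP => j.
  rewrite -/U mxE eqxx /=; case: eqVneq => [->//|j0].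
  have := U1; rewrite (bigD1 ord0)//= U0 expr1n => /eqP.
  rewrite -subr_eq0 addrAC subrr add0r psumr_eq0; last by move=> l _; exact: sqr_ge0.
  by move=> /allP/(_ j (mem_index_enum j)); rewrite j0 sqrf_eq0 => /eqP.
have V0 : 1 - U 0 ord0 != 0 by rewrite subr_eq0 gt_eqF.
pose e j : R := U 0 j / (1 - U 0 ord0) * (j != ord0)%:R.
have [k _ kmin] := @arg_minP _ R 'I_d.+1 ord0 xpredT e isT.
have D0 : d.+1%:R != 0 :> R by rewrite pnatr_eq0.
pose Q := 1 + \sum_j e j - d.+1%:R * e k.
have Q1 : 1 <= Q.
  rewrite /Q -addrA lerDl subr_ge0 mulr_natl -[X in _ *+ X]card_ord -sumr_const.
  by apply: ler_sum => j _; exact: kmin.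
have Q0 : 0 < Q by exact: lt_le_trans Q1.
pose h := Q^-1; have h0 : 0 < h by rewrite invr_gt0.
pose c j := h * (1 / d.+1%:R + e j - e k).
have c_ge j : h / d.+1%:R <= c j.
  by rewrite /c -addrA mulrDr mul1r lerDl mulr_ge0 ?(ltW h0)// subr_ge0 kmin.
have c_ge0 j : 0 <= c j.
  by apply: le_trans (c_ge j); rewrite divr_ge0 ?(ltW h0).
have sum_c : \sum_j c j = 1.
  rewrite -mulr_sumr sumrB big_split/= !sumr_const card_ord.
  rewrite -[X in X + _ - _]mulr_natl -[X in _ - X]mulr_natl mul1r divff// -/Q.
  by rewrite mulVf// gt_eqF.
pose x : {ptws V -> R} := fun v => \sum_(j | p i j == v) c j.
have xp j : x (p i j) = c j.
  by rewrite /x (big_pred1 j)// => l; rewrite (inj_eq (@p_inj i)).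
have Kx : geom K x.
  split=> [v||]; first exact: sumr_ge0.
    by rewrite -[RHS]sum_c [RHS](partition_big (p i) xpredT).
  apply: clK (F_K i); apply/fintype.subsetP => v; rewrite inE.
  apply: contraR => vF; rewrite /x big1// => j /eqP jv.
  by move: vF; rewrite -jv p_F.
have hE : height i x = h.
  have -> : h = d.+1%:R * (h / d.+1%:R) by rewrite mulrC divfK.
  congr (_ * _); apply/eqP; rewrite eq_le; apply/andP; split.
    apply: le_trans (least_le x (p_F i k)) _; rewrite xp /c addrK.
    by rewrite mul1r.
  apply: le_least => [|v /finset.imsetP[j _ ->]]; last by rewrite xp.
  rewrite ler_pdivrMr ?ltr0Sn// mul1r (le_trans (y := 1))//.
    by rewrite invf_le1.
  by rewrite ler1n.
exists (to_set_type Kx); first by rewrite /= hE.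
have e0 : e ord0 = 0 by rewrite /e eqxx mulr0.
have offE j : offset i x j = h * e j.
  by rewrite /offset !xp /c e0; ring.
pose n := \sum_j e j ^+ 2.
have sqE : sqnorm i x = h ^+ 2 * n.
  rewrite /sqnorm (eq_bigr _ (fun j _ => xp j)) sum_c subrr expr0n addr0.
  by rewrite mulr_sumr; apply: eq_bigr => j _; rewrite offE exprMn.
have nE : n * (1 - U 0 ord0) = 1 + U 0 ord0.
  apply: (mulIf V0); rewrite -mulrA -expr2.
  have -> : (1 + U 0 ord0) * (1 - U 0 ord0) = \sum_(j | j != ord0) U 0 j ^+ 2.
    by move: U1; rewrite (bigD1 ord0)//= => U1; rewrite -[LHS]/(_ * _); lra.
  rewrite /n mulr_suml (bigD1 ord0)//= e0 expr0n mul0r add0r.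
  apply: eq_bigr => j j0; rewrite /e j0 mulr1 expr_div_n divfK//.
  by rewrite expf_neq0.
apply: val_inj; apply/rowP => j; rewrite /= mxE sqE hE offE -/U.
have h_neq0 : h != 0 by rewrite gt_eqF.
have [->|j0] := eqVneq j ord0.
  by rewrite mulr1 e0 !mulr0 addr0 (projection_pole h_neq0 V0 nE).
by rewrite mulr0 add0r /e j0 mulr1 (projection_equator _ h_neq0 V0 nE).
Qed.

Let W := @wedge 'I_m.+1 (fun=> sphere R d) (fun=> sphere_base R d).

Let lift i (u : sphere R d) : W :=
  @wedge_lift 'I_m.+1 (fun=> sphere R d) (fun=> sphere_base R d) i u.

Let lift_bubble i (y : polyhedron R K) : W := lift i (bubble i y).

(** On [L] every [lift_bubble i] is constant with value the base point of the wedge, so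
the choice of [ord0] there does not matter. *)
Let quotient (y : polyhedron R K) : W :=
  if [pick i | 0 < height i (\val y)] is Some i then lift_bubble i y
  else lift_bubble ord0 y.

Let quotient_facet i (y : polyhedron R K) : 0 < height i (\val y) ->
  quotient y = lift_bubble i y.
Proof.
move=> hi; rewrite /quotient; case: pickP => [j hj|/(_ i)]; last by rewrite hi.
have [->//|ij] := eqVneq i j.
by have := height_neq (polyhedronP y) hj ij => hi0; rewrite hi0 ltxx in hi.
Qed.

Let quotient_low i (y : polyhedron R K) : in_L y -> quotient y = lift_bubble i y.
Proof.
move=> Ly; rewrite /quotient; case: pickP => [j|_].
  by rewrite height_L ?ltxx.
rewrite /lift_bubble !bubble_pole ?height_L//.
exact: (@wedge_liftE _ (fun=> sphere R d) (fun=> sphere_base R d) _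
  (sphere_base R d) _ (sphere_base R d)).
Qed.

Let quotient_cases (y : polyhedron R K) :
  in_L y \/ exists2 i, 0 < height i (\val y) & quotient y = lift_bubble i y.
Proof.
have [Ly|[i hi _]] := geom_cases (polyhedronP y); first by left.
by right; exists i => //; exact: quotient_facet.
Qed.

Let continuous_lift_bubble i : continuous (lift_bubble i).
Proof.
have cl : continuous (lift i) :=
  @wedge_lift_continuous 'I_m.+1 (fun=> sphere R d) (fun=> sphere_base R d) i.
exact: (continuous_compose (@continuous_bubble i) cl).
Qed.

Let continuous_quotient : continuous quotient.
Proof.
move=> y U qU; have [Ly|[i hi qy]] := quotient_cases y.
  have : \forall z \near y, forall i, U (lift_bubble i z).
    apply: (@filter_forall _ _ (fun i z => U (lift_bubble i z)) (nbhs y)) => i.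
    have Ui : nbhs (lift_bubble i y) U by rewrite -(quotient_low i Ly).
    exact: (@continuous_lift_bubble i y U Ui).
  apply: filterS => z Uz /=; have [Lz|[i _ ->]] := quotient_cases z => //.
  by rewrite (quotient_low ord0 Lz).
have ch : continuous (fun z : polyhedron R K => height i (\val z)).
  by apply: (continuous_height (f := idfun)) => z; exact: cvg_id.
have near_hi : \forall z \near y, 0 < height i (\val z).
  exact: (ch y _ (open_nbhs_nbhs (conj (@open_gt R 0) hi))).
have near_U : \forall z \near y, U (lift_bubble i z).
  have Ui : nbhs (lift_bubble i y) U by rewrite -qy.
  exact: (@continuous_lift_bubble i y U Ui).
by apply: filterS2 near_hi near_U => z hz Uz /=; rewrite (quotient_facet hz).
Qed.

Let quotient_onto (w : W) : exists y, quotient y = w.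
Proof.
have [a _] := contrL; have [i [u uw]] : exists i u, lift i u = w.
  have : [set: W] w by [].
  by rewrite -wedgeTE => -[i _ [u _ uw]]; exists i, u.
have [uE|u_pole] := pselect (u = sphere_base R d).
  exists (to_set_type (geom_LK (polyhedronP a))).
  rewrite (quotient_low i); last exact: polyhedronP.
  rewrite /lift_bubble bubble_pole -?uw ?uE//.
  by apply: height_L; exact: polyhedronP.
have [y hy yu] := bubble_onto i u_pole; exists y.
by rewrite (quotient_facet hy) /lift_bubble yu.
Qed.

Let quotient_eq (y z : polyhedron R K) : quotient y = quotient z ->
  y = z \/ in_L y /\ in_L z.
Proof.
have pole_L i (t : polyhedron R K) : 0 < height i (\val t) ->
    bubble i t <> sphere_base R d.
  by move=> ht /bubble_pole_inv ht0; rewrite ht0 ltxx in ht.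
have lift_eq i j (u v : sphere R d) :
    lift i u = lift j v ->
    (i = j /\ u = v) \/ (u = sphere_base R d /\ v = sphere_base R d).
  move=> /eqmodP/orP[/eqP E|/andP[/eqP/= uE /eqP/= vE]]; last by right.
  left; split; first exact: (congr1 (@projT1 _ _) E).
  exact: (congr1 (fun t : {_ : 'I_m.+1 & sphere R d} => projT2 t) E).
have [Ly|[i hi ->]] := quotient_cases y; have [Lz|[j hj ->]] := quotient_cases z.
- by right.
- rewrite (quotient_low j Ly) => /lift_eq[[_]|[_]]; last by move/(pole_L _ _ hj).
  rewrite (bubble_pole (height_L j Ly)) => /esym.
  by move/(pole_L _ _ hj).
- rewrite (quotient_low i Lz) => /lift_eq[[_]|[]]; last by move/(pole_L _ _ hi).
  by rewrite (bubble_pole (height_L i Lz)) => /(pole_L _ _ hi).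
- move=> /lift_eq[[ij yz]|[]]; last by move/(pole_L _ _ hi).
  by left; rewrite -ij in hj yz; exact: bubble_inj hi hj yz.
Qed.

(** The quotient map identifies the points of [L] only, and the extended contraction
moves [L] inside itself to one point. *)
Lemma facets_equivalence : homotopy_equivalent R (polyhedron R K) W.
Proof.
have [h [ch h0 hL h1]] := contraction_extends.
apply: (quotient_equivalence (q := quotient) (h := h)) => //.
- exact/compact_set_type/compact_geom.
- apply: wedge_hausdorff => _; apply: hausdorff_set_type.
  exact: norm_hausdorff.
- move=> y z t /quotient_eq[->//|[Ly Lz]].
  rewrite (quotient_low ord0 (hL _ t Ly)) (quotient_low ord0 (hL _ t Lz)).
  rewrite /lift_bubble !bubble_pole//; apply: height_L; exact: hL.
- by move=> y z /quotient_eq[->//|[Ly Lz]]; exact: h1.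
Qed.

End Facets.

Section MorseRealization.
Variables (R : realType) (V : finType).

Lemma facets_sphere_wedge d (L C : {set {set V}}) :
  collapses finset.set0 L -> face_closed L -> face_closed (L :|: C) ->
  L != finset.set0 ->
  (forall s, s \in C -> (s \notin L) && (#|s| == d.+1)%N) ->
  homotopy_equivalent R (polyhedron R (L :|: C)) (sphere_wedge R #|C| d).
Proof.
move=> colL clL clK L0 CP; have contrL := collapses_contractible R L0 colL.
case cC : #|C| => [|m].
  move/finset.cards0_eq: cC => ->; rewrite finset.setU0.
  apply: (@contractible_point _ _ (set_type [set sphere_base R d])
    (@to_set_type _ [set sphere_base R d] (sphere_base R d) erefl)) => // z.
  by apply: val_inj; exact: (set_valP z).
pose A (i : 'I_m.+1) : {set V} := enum_val (cast_ord (esym cC) i).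
have AC i : A i \in C by exact: enum_valP.
have A_inj : injective A by move=> i j /enum_val_inj/cast_ord_inj.
have cA i : #|A i| = d.+1 by have /andP[_ /eqP] := CP _ (AC i).
pose p i (j : 'I_d.+1) : V := enum_val (cast_ord (esym (cA i)) j).
have p_inj i : injective (p i) by move=> j k /enum_val_inj/cast_ord_inj.
have pA i : [set p i j | j : 'I_d.+1]%SET = A i.
  apply/finset.setP => v; apply/finset.imsetP/idP => [[j _ ->]|vA].
    exact: enum_valP.
  exists (cast_ord (cA i) (enum_rank_in vA v)) => //.
  by rewrite /p cast_ordK enum_rankK_in.
have KE : L :|: C = L :|: [set [set p i j | j : 'I_d.+1]%SET | i : 'I_m.+1]%SET.
  congr (_ :|: _); apply/finset.setP => s; apply/idP/finset.imsetP => [sC|[i _ ->]].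
    exists (cast_ord cC (enum_rank_in sC s)) => //.
    by rewrite pA /A cast_ordK enum_rankK_in.
  by rewrite pA.
rewrite KE in clK *; apply: facets_equivalence => //.
- by move=> i j; rewrite !pA; exact: A_inj.
- by move=> i; rewrite pA; have /andP[] := CP _ (AC i).
Qed.

(** The size of the critical simplices being constant, the reduction can be sorted so
that they are attached last, all at once, to a contractible complex. *)
Lemma reduces_sphere_wedge d (K : {set {set V}}) m : finset.set0 \in K ->
  reduces d.+1 finset.set0 K m ->
  homotopy_equivalent R (polyhedron R K) (sphere_wedge R m d).
Proof.
move=> K0 /reduces_split[L [C [[colL clL colK <- CP] [LP clLC]]]].
have L0 : finset.set0 \in L by apply: LP; rewrite ?finset.cards0.
apply: (@homotopy_equivalent_trans _ _ (polyhedron R (L :|: C))).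
  by apply: collapses_equivalence colK => //; rewrite finset.in_setU L0.
by apply: facets_sphere_wedge => //; apply/finset.set0Pn; exists finset.set0.
Qed.

End MorseRealization.

Theorem theorem1p1 (R : realType) (n k l : nat) (hn : (1 <= n)%N)
    (hl : (l <= 5)%N) (hnkl : n = (6 * k + l)%N) :
  homotopy_equivalent R
    (realization R (independence_complex (grid_graph n 4)))
    (sphere_wedge R
       (match l with
        | 1 => 2 * k
        | 4 => 2 * k + 2
        | _ => 2 * k + 1
        end)%N
       (n - 1)%N).
Proof.
have nE : n = (n - 1).+1 by rewrite subn1 prednK.
apply: (@reduces_sphere_wedge _ _ _ (independent_sets (grid_graph n 4))).
  by rewrite !inE; apply/forall_inP => x; rewrite inE.
rewrite -nE; exact: grid_reduces.
Qed.
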